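(* Assume there exists $k\ge0$ such that \[ |\mathrm{Im}\,\langle Dz,z\rangle|\le k\,\mathrm{Re}\,\langle Dz,z\rangle,\qquad z\in H_1. \] (i) If $\beta>0$, then \[ \sigma(\mathcal A)\subset\{\lambda\in\mathbb C\mid\mathrm{Re}\,\lambda<0,\ |\mathrm{Im}\,\lambda|\le h_{\rm i}(|\mathrm{Re}\,\lambda|)\}, \] where $h_{\rm i}:[0,\infty)\to[0,\infty]$ is given by $h_{\rm i}(t)=\frac{1}{1-\frac2\beta t}\,kt$ for $0\le t<\frac\beta2$ and $h_{\rm i}(t)=\infty$ for $\frac\beta2\le t<\infty$; if $\gamma<\infty$ and there is a $\lambda_0\in\rho(\mathcal A)$ with $\mathrm{Re}\,\lambda_0<-\gamma$, then \[ \sigma(\mathcal A)\subset\{\lambda\in\mathbb C\mid-\gamma\le\mathrm{Re}\,\lambda<0,\ |\mathrm{Im}\,\lambda|\le h_{\rm i}(|\mathrm{Re}\,\lambda|)\}. \] (ii) If $\mu>0$, then \[ \sigma(\mathcal A)\subset\{\lambda\in\mathbb C\mid-\gamma\le\mathrm{Re}\,\lambda<0,\ |\mathrm{Im}\,\lambda|\le h_{\rm ii}(|\mathrm{Re}\,\lambda|)\}, \] where $h_{\rm ii}:[0,\infty)\to[0,\infty)$ is given by \[ h_{\rm ii}(t):=k_\mu t,\qquad k_\mu^2:=\frac2{\mu^2}+\frac{k^2-1}2+\sqrt{\Big(\frac2{\mu^2}+\frac{k^2-1}2\Big)^2+k^2}, \] with $k_\mu\in[0,\infty)$ satisfying $k\le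 k_\mu\le\sqrt{k^2+\frac4{\mu^2}}$. (iii) If $\delta>0$, then \[ \sigma(\mathcal A)\subset\{\lambda\in\mathbb C\mid-\gamma\le\mathrm{Re}\,\lambda<0,\ |\mathrm{Im}\,\lambda|\le h_{\rm iii}(|\mathrm{Re}\,\lambda|)\}, \] where $h_{\rm iii}:[0,\infty)\to[0,\infty)$ is defined by $h_{\rm iii}(t)$ being the largest non-negative solution $y$ of \[ (y^2+t^2)(y-kt)=\frac2\delta\,ty, \] which satisfies the estimates \[ kt\le h_{\rm iii}(t)\le\min\Big\{kt+\frac1\delta,\ \frac{kt}2+\sqrt{\Big(\frac{kt}2\Big)^2+\frac{2t}\delta}\Big\}\le kt+\min\Big\{\frac1\delta,\sqrt{\frac{2t}\delta}\Big\},\qquad t\in[0,\infty). \]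
   Context: $H$ is a (complex) Hilbert space with inner product $\langle\cdot,\cdot\rangle$ and norm $\|\cdot\|$. $A_0:\mathcal D(A_0)\subset H\to H$ is a self-adjoint, uniformly positive linear operator with $0\in\rho(A_0)$. $H_{1/2}:=\mathcal D(A_0^{1/2})$ with norm $\|z\|_{H_{1/2}}=\|A_0^{1/2}z\|$ and inner product $\langle x,y\rangle_{H_{1/2}}=\langle A_0^{1/2}x,A_0^{1/2}y\rangle$; $H_{-1/2}$ is the dual of $H_{1/2}$ with respect to the pivot space $H$, i.e. the completion of $H$ with respect to $\|A_0^{-1/2}z\|$; $\langle\cdot,\cdot\rangle_{H_{-1/2}\times H_{1/2}}$ is the duality pairing, with $\langle z',z\rangle_{H_{-1/2}\times H_{1/2}}=\langle z',z\rangle$ for $z'\in H$, $z\in H_{1/2}$. $H_1:=\mathcal D(A_0)$. $A_0$ extends to a bounded operator $H_{1/2}\to H_{-1/2}$, again denoted $A_0$. $D:H_{1/2}\to H_{-1/2}$ is a bounded linear operator such that $\mathrm{Re}\,\langle Dz,z\rangle_{H_{-1/2}\times H_{1/2}}\ge 0$ for all $z\in H_{1/2}$, and $D$ maps $H_1$ into $H$. The operator $\mathcal A$ in $H_{1/2}\times H$ is $\mathcal A=\begin{bmatrix}0&I\\-A_0&-D\end{bmatrix}$ with $\mathcal D(\mathcal A)=\{(z,w)^\top\in H_{1/2}\times H_{1/2}\mid A_0z+Dw\in H\}$. Constants (with $z$ ranging over $H_{1/2}\setminus\{0\}$ and $\langle Dz,z\rangle$ short for $\langle Dz,z\rangle_{H_{-1/2}\times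 H_{1/2}}$): \[ \beta=\inf_z\frac{\mathrm{Re}\,\langle Dz,z\rangle}{\|z\|^2},\quad \gamma=\sup_z\frac{\mathrm{Re}\,\langle Dz,z\rangle}{\|z\|^2}\in[0,\infty],\quad \delta=\inf_z\frac{\mathrm{Re}\,\langle Dz,z\rangle}{\|z\|_{H_{1/2}}^2},\quad \mu=\inf_z\frac{\mathrm{Re}\,\langle Dz,z\rangle}{\|z\|\,\|z\|_{H_{1/2}}}. \] If $\gamma=\infty$, the condition $-\gamma\le\mathrm{Re}\,\lambda$ is void. *)

(* Defs.v *)
From HB Require Import structures.
From mathcomp Require Import all_boot all_order all_algebra.
From mathcomp Require Import sesquilinear complex ring.
From mathcomp Require Import all_classical all_reals all_analysis.

Set Implicit Arguments.
Unset Strict Implicit.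
Unset Printing Implicit Defensive.

Import Order.TTheory GRing.Theory Num.Theory.
Import numFieldNormedType.Exports.

Local Open Scope classical_set_scope.
Local Open Scope complex_scope.
Local Open Scope ring_scope.

(* The inner product of a complex Hilbert space: linear in the first argument,
   conjugate-linear in the second, and inducing the norm. *)
HB.mixin Record CompleteNormedModule_isHilbert (R : realType) H
    & CompleteNormedModule R[i] H := {
  inner : {dot H for @Num.conj R[i]};
  inner_norm : forall x : H, inner x x = `|x| ^+ 2
}.

#[short(type="hilbertType")]
HB.structure Definition Hilbert (R : realType) :=
  {H of CompleteNormedModule R[i] H & CompleteNormedModule_isHilbert R H}.

(* Norms take values in R[i]; [rnorm] is the same number as an element of R. *)
Definition rnorm (R : realType) (V : normedModType R[i]) (x : V) : R :=
  complex.Re `|x|.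

Definition bounded_operator (R : realType) (V W : normedModType R[i])
    (f : V -> W) : Prop :=
  exists M : R, forall x, `|f x| <= M%:C * `|x|.

(* Unbounded operators: the values of [op] outside [dom] are irrelevant. *)
Record operator (K : pzRingType) (V W : lmodType K) := Operator {
  dom : set V;
  op :> V -> W;
  dom0 : dom 0;
  dom_lin : forall a x y, dom x -> dom y -> dom (a *: x + y);
  op_lin : forall a x y, dom x -> dom y -> op (a *: x + y) = a *: op x + op y
}.

Section OperatorTheory.
Variables (K : pzRingType) (V W : lmodType K) (A : operator V W).

Lemma op0 : A 0 = 0.
Proof.
have := op_lin (-1) (dom0 A) (dom0 A).
by rewrite scaleN1r oppr0 addr0 scaleN1r addNr.
Qed.

Lemma opD x y : dom A x -> dom A y -> A (x + y) = A x + A y.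
Proof. by move=> dx dy; have := op_lin 1 dx dy; rewrite !scale1r. Qed.

Lemma opZ a x : dom A x -> A (a *: x) = a *: A x.
Proof. by move=> dx; have := op_lin a dx (dom0 A); rewrite op0 !addr0. Qed.

Lemma domB x y : dom A x -> dom A y -> dom A (x - y).
Proof. by move=> dx dy; rewrite addrC -scaleN1r; exact: dom_lin. Qed.

Lemma opB x y : dom A x -> dom A y -> A (x - y) = A x - A y.
Proof.
by move=> dx dy; rewrite addrC -scaleN1r op_lin// scaleN1r addrC.
Qed.

End OperatorTheory.

Section Spectrum.
Variables (R : realType) (X : normedModType R[i]).

Definition resolvent_set (A : operator X X) : set R[i] :=
  [set l | set_bij (dom A) [set: X] (fun x => A x - l *: x) /\
           exists M : R, forall x, dom A x -> `|x| <= M%:C * `|A x - l *: x|].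

Definition spectrum (A : operator X X) : set R[i] := ~` resolvent_set A.

End Spectrum.

Section HilbertOperators.
Variables (R : realType) (H : hilbertType R).
Implicit Types A S : operator H H.

(* (y, z) belongs to the graph of the adjoint of A. *)
Definition adjoint_graph A (y z : H) : Prop :=
  forall x, dom A x -> inner (A x) y = inner x z.

Definition self_adjoint A : Prop :=
  dense (dom A) /\ forall y z, adjoint_graph A y z <-> dom A y /\ A y = z.

Definition nonnegative A : Prop :=
  forall x, dom A x -> 0 <= inner (A x) x.

Definition uniformly_positive A : Prop :=
  exists2 c : R, 0 < c & forall x, dom A x -> c%:C * `|x| ^+ 2 <= inner (A x) x.

(* S is the nonnegative self-adjoint square root of A. *)
Definition is_sqrt_of S A : Prop :=
  [/\ self_adjoint S, nonnegative S,
      forall x, dom A x <-> dom S x /\ dom S (S x) &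
      forall x, dom A x -> A x = S (S x)].

Lemma innerC (x y : H) : inner x y = (inner y x)^*%R.
Proof. by rewrite hermC expr0 mul1r. Qed.

Lemma innerDl (x y z : H) : inner (x + y) z = inner x z + inner y z.
Proof. exact: linearDl. Qed.

Lemma innerZl a (x y : H) : inner (a *: x) y = a * inner x y.
Proof. exact: linearZl_LR. Qed.

Lemma innerDr (x y z : H) : inner x (y + z) = inner x y + inner x z.
Proof. exact: linearDr. Qed.

Lemma innerZr a (x y : H) : inner x (a *: y) = a^*%R * inner x y.
Proof. exact: linearZr. Qed.

Lemma innerNl (x y : H) : inner (- x) y = - inner x y.
Proof. by rewrite -scaleN1r innerZl mulN1r. Qed.

Lemma innerNr (x y : H) : inner x (- y) = - inner x y.
Proof. by rewrite -scaleN1r innerZr rmorphN1 mulN1r. Qed.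

Lemma CauchySchwarz_inner (x y : H) : `|inner x y| <= `|x| * `|y|.
Proof.
have [->|y0] := eqVneq y 0; first by rewrite linear0r !normr0 mulr0.
have yy : 0 < `|y| ^+ 2 by rewrite exprn_gt0// normr_gt0.
pose c := inner x y; pose u := `|y| ^+ 2 *: x - c *: y.
have : 0 <= inner u u by rewrite inner_norm exprn_ge0.
have -> : inner u u = `|y| ^+ 2 * ((`|x| * `|y|) ^+ 2 - `|c| ^+ 2).
  rewrite /u !(innerDl, innerDr, innerNl, innerNr, innerZl, innerZr).
  rewrite (innerC y x) -/c !inner_norm normCK.
  have -> : (`|y| ^+ 2)^*%R = `|y| ^+ 2.
    by rewrite conj_Creal// rpredX// normr_real.
  ring.
by rewrite pmulr_rge0// subr_ge0 ler_sqr ?nnegrE// mulr_ge0.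
Qed.

End HilbertOperators.

Record positive_operator (R : realType) (H : hilbertType R) := PositiveOperator {
  A0 :> operator H H;
  A0_self_adjoint : self_adjoint A0;
  A0_uniformly_positive : uniformly_positive A0;
  A0_resolvent : resolvent_set A0 0;
  A0half : operator H H;
  A0half_sqrt : is_sqrt_of A0half A0
}.

Section HalfSpace.
Variables (R : realType) (H : hilbertType R) (T : positive_operator H).
Local Notation S := (A0half T).

Lemma A0half_sym (x y : H) : dom S x -> dom S y -> inner (S x) y = inner x (S y).
Proof.
case: (A0half_sqrt T) => -[_ Ssa] _ _ _ dx dy.
by have [_ /(_ (conj dy erefl)) ->] := Ssa y (S y).
Qed.

Lemma A0half_dense : dense (dom S).
Proof. by case: (A0half_sqrt T) => -[]. Qed.

Lemma A0half_surj (y : H) : exists2 x, dom S x & S x = y.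
Proof.
have [_ _ dA eA] := A0half_sqrt T.
have [[_ _ surjA] _] := A0_resolvent T.
have [x dx /=] := surjA y I; rewrite scale0r subr0 => <-.
by have /dA[? ?] := dx; exists (S x) => //; rewrite eA.
Qed.

Lemma A0half_inj (x : H) : dom S x -> S x = 0 -> x = 0.
Proof.
move=> dx Sx0; have [_ _ dA eA] := A0half_sqrt T.
have dAx : dom T x by apply/dA; rewrite Sx0; split=> //; exact: dom0.
have [_ [M]] := A0_resolvent T => /(_ x dAx).
rewrite eA// Sx0 op0 scale0r subrr normr0 mulr0 normr_le0.
by move/eqP.
Qed.

Lemma A0half_bounded_below :
  exists2 M : R, 0 < M & forall x, dom S x -> `|x| <= M%:C * `|S x|.
Proof.
have [_ _ dA eA] := A0half_sqrt T.
have [[_ _ surjA] [M0 bA]] := A0_resolvent T.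
pose M := `|M0| + 1.
have M_gt0 : 0 < M by rewrite ltr_wpDl.
have M_ge0 : 0 <= M%:C by rewrite lecR ltW.
exists (Num.sqrt M) => [|x dx]; first by rewrite sqrtr_gt0.
have [u du /=] := surjA (S x) I; rewrite scale0r subr0 => Au.
have [du1 du2] := (dA u).1 du.
have Su : S u = x.
  apply/eqP; rewrite -subr_eq0; apply/eqP; apply: A0half_inj; first exact: domB.
  by rewrite opB// -eA// Au subrr.
have bu : `|u| <= M%:C * `|S x|.
  have := bA u du; rewrite scale0r subr0 Au => /le_trans; apply.
  by rewrite ler_wpM2r// lecR /M (le_trans (ler_norm _))// lerDl.
rewrite -ler_sqr ?nnegrE ?mulr_ge0// ?lecR ?sqrtr_ge0// exprMn.
have E : `|x| ^+ 2 = inner (S x) u by rewrite A0half_sym// Su inner_norm.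
rewrite -rmorphXn/= (sqr_sqrtr (ltW M_gt0)) E.
apply: (@le_trans _ _ `|inner (S x) u|).
  by rewrite real_ler_norm// -E rpredX// normr_real.
rewrite (le_trans (CauchySchwarz_inner _ _))//.
by rewrite [_ * `|u|]mulrC expr2 mulrA ler_wpM2r.
Qed.

(* H_{1/2} = D(A_0^{1/2}). *)
Definition half_pred : {pred H} := fun x => `[< dom S x >].

Lemma half_pred_submod : subsemimod_closed half_pred.
Proof.
split; first split.
- by apply/asboolP; exact: dom0.
- move=> x y /asboolP dx /asboolP dy; apply/asboolP.
  by rewrite -[x]scale1r; exact: dom_lin.
- move=> a x /asboolP dx; apply/asboolP.
  by rewrite -[_ *: _]addr0; apply: dom_lin => //; exact: dom0.
Qed.

HB.instance Definition _ :=
  GRing.isSubmodClosed.Build R[i] H half_pred half_pred_submod.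

Record Hhalf := MkHhalf { hval : H; _ : half_pred hval }.

HB.instance Definition _ := [isSub for hval].
HB.instance Definition _ := [Choice of Hhalf by <:].
HB.instance Definition _ := [SubChoice_isSubLmodule of Hhalf by <:].

Lemma hval_dom (x : Hhalf) : dom S (hval x).
Proof. by apply/asboolP; case: x. Qed.

Lemma hvalD (x y : Hhalf) : hval (x + y) = hval x + hval y.
Proof. exact: (raddfD (val : Hhalf -> H)). Qed.

Lemma hvalZ a (x : Hhalf) : hval (a *: x) = a *: hval x.
Proof. exact: (linearZ_LR (val : Hhalf -> H)). Qed.

Lemma Hhalf_normD (x y : Hhalf) :
  `|S (hval (x + y))| <= `|S (hval x)| + `|S (hval y)|.
Proof. by rewrite hvalD opD ?ler_normD//; exact: hval_dom. Qed.

Lemma Hhalf_normZ (a : R[i]) (x : Hhalf) :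
  `|S (hval (a *: x))| = `|a| * `|S (hval x)|.
Proof. by rewrite hvalZ opZ ?normrZ//; exact: hval_dom. Qed.

Lemma Hhalf_norm0 (x : Hhalf) : `|S (hval x)| = 0 -> x = 0.
Proof.
move=> /eqP; rewrite normr_eq0 => /eqP /A0half_inj -/(_ (hval_dom x)) x0.
exact/val_inj.
Qed.

HB.instance Definition _ := Lmodule_isNormed.Build R[i] Hhalf
  Hhalf_normD Hhalf_normZ Hhalf_norm0.

Lemma Hhalf_normE (x : Hhalf) : `|x| = `|S (hval x)|.
Proof. by []. Qed.

End HalfSpace.

(* The antidual of V: the bounded conjugate-linear functionals on V, with the
   operator norm. *)
Section Antidual.
Variables (R : realType) (V : normedModType R[i]).

Lemma realCD (x y : R) : (x + y)%:C = x%:C + y%:C.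
Proof. exact: rmorphD. Qed.

Lemma realCM (x y : R) : (x * y)%:C = x%:C * y%:C.
Proof. exact: rmorphM. Qed.

Lemma ReN (W : normedZmodType R[i]) (z : W) : (complex.Re `|z|)%:C = `|z|.
Proof. by rewrite RRe_real// normr_real. Qed.

Definition antidual_pred : {pred V -> R[i]^o} := fun f =>
  `[< (forall a x y, f (a *: x + y) = a^*%R * f x + f y) /\
      bounded_operator f >].

Lemma antidual_pred_submod : subsemimod_closed antidual_pred.
Proof.
split; first split.
- apply/asboolP; split=> [a x y|]; first by rewrite mulr0 addr0.
  by exists 0 => x; rewrite normr0 mul0r.
- move=> f g /asboolP[fl [M fM]] /asboolP[gl [N gN]]; apply/asboolP; split.
    by move=> a x y; rewrite !fctE fl gl; ring.
  exists (M + N) => x; rewrite realCD mulrDl.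
  by rewrite (le_trans (ler_normD _ _))// lerD.
- move=> a f /asboolP[fl [M fM]]; apply/asboolP; split.
    by move=> b x y; rewrite !fctE fl /GRing.scale/=; ring.
  exists (complex.Re `|a| * M) => x.
  rewrite realCM ReN -mulrA.
  by rewrite (_ : `|_| = `|a| * `|f x|) ?ler_wpM2l// -normrM.
Qed.

HB.instance Definition _ := GRing.isSubmodClosed.Build R[i] (V -> R[i]^o)
  antidual_pred antidual_pred_submod.

Record antidual := Antidual { adval :> V -> R[i]^o; _ : antidual_pred adval }.

HB.instance Definition _ := [isSub for adval].
HB.instance Definition _ := [Choice of antidual by <:].
HB.instance Definition _ := [SubChoice_isSubLmodule of antidual by <:].

Lemma antidualP (f : antidual) : antidual_pred f.
Proof. by case: f. Qed.

Lemma antidual_lin (f : antidual) a x y : f (a *: x + y) = a^*%R * f x + f y.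
Proof. by have /asboolP[+ _] := antidualP f; exact. Qed.

Lemma antidual_bounded (f : antidual) : bounded_operator f.
Proof. by have /asboolP[_] := antidualP f. Qed.

Lemma antidualDE (f g : antidual) x : (f + g) x = f x + g x.
Proof. by []. Qed.

Lemma antidualZE a (f : antidual) x : (a *: f) x = a * f x.
Proof. by []. Qed.

Lemma antidual_eq (f g : antidual) : (forall x, f x = g x) -> f = g.
Proof. by move=> fg; apply/val_inj/funext. Qed.

Lemma antidual0r (f : antidual) : f 0 = 0.
Proof.
have := antidual_lin f (-1) 0 0.
by rewrite scaler0 addr0 rmorphN1 mulN1r addNr.
Qed.

Lemma antidualZr (f : antidual) a x : f (a *: x) = a^*%R * f x.
Proof. by rewrite -[_ *: x]addr0 antidual_lin antidual0r addr0. Qed.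

Definition dual_norm (f : antidual) : R :=
  sup [set complex.Re `|f x| | x in [set x : V | `|x| <= 1]].

Lemma dual_norm_has_sup (f : antidual) :
  has_sup [set complex.Re `|f x| | x in [set x : V | `|x| <= 1]].
Proof.
split; first by exists (complex.Re `|f 0|), 0; rewrite //= normr0.
have [M fM] := antidual_bounded f.
exists `|M| => _ [x x1 <-]; have {}x1 : `|x| <= 1 by [].
rewrite -lecR ReN (le_trans (fM x))//.
apply: (@le_trans _ _ (`|M|%:C * `|x|)).
  by rewrite ler_wpM2r// lecR ler_norm.
by rewrite ler_piMr// lecR.
Qed.

Lemma dual_norm_ge (f : antidual) x : `|x| <= 1 -> `|f x| <= (dual_norm f)%:C.
Proof.
move=> x1; rewrite -ReN lecR; apply: (sup_upper_bound (dual_norm_has_sup f)).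
by exists x.
Qed.

Lemma dual_norm_le (f : antidual) (M : R) :
  (forall x, `|x| <= 1 -> `|f x| <= M%:C) -> dual_norm f <= M.
Proof.
move=> fM; apply: ge_sup; first by case: (dual_norm_has_sup f).
by move=> _ [x x1 <-]; rewrite -lecR ReN fM.
Qed.

Lemma antidual_normM (f : antidual) x : `|f x| <= (dual_norm f)%:C * `|x|.
Proof.
have [->|x0] := eqVneq x 0; first by rewrite antidual0r !normr0 mulr0.
have nx0 : 0 < `|x| by rewrite normr_gt0.
have := @dual_norm_ge f (`|x|^-1 *: x).
rewrite normrZ normfV normr_id mulVf ?gt_eqF// antidualZr => /(_ (lexx _)).
by rewrite normrM norm_conjC normfV normr_id ler_pdivrMl// mulrC.
Qed.

Lemma antidual_normD (f g : antidual) :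
  (dual_norm (f + g))%:C <= (dual_norm f)%:C + (dual_norm g)%:C.
Proof.
rewrite -realCD lecR; apply: dual_norm_le => x x1.
by rewrite realCD antidualDE (le_trans (ler_normD _ _))// lerD// dual_norm_ge.
Qed.

Lemma dual_norm_ge0 (f : antidual) : 0 <= dual_norm f.
Proof.
rewrite -lecR (le_trans _ (@dual_norm_ge f 0 _))// ?normr_ge0//.
by rewrite normr0.
Qed.

Lemma antidual_norm0 (f : antidual) : (dual_norm f)%:C = 0 -> f = 0.
Proof.
move=> f0; apply: antidual_eq => x; have := antidual_normM f x.
by rewrite f0 mul0r normr_le0 => /eqP.
Qed.

Lemma antidual_normZ a (f : antidual) :
  (dual_norm (a *: f))%:C = `|a| * (dual_norm f)%:C.
Proof.
have le b (g : antidual) : (dual_norm (b *: g))%:C <= `|b| * (dual_norm g)%:C.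
  rewrite -ReN -realCM lecR; apply: dual_norm_le => x x1.
  rewrite realCM ReN antidualZE normrM.
  by rewrite ler_wpM2l// dual_norm_ge.
apply/eqP; rewrite eq_le le/=; have [->|a0] := eqVneq a 0.
  by rewrite normr0 mul0r lecR dual_norm_ge0.
have := le a^-1 (a *: f); rewrite scalerA mulVf// scale1r normfV.
by rewrite ler_pdivlMl// normr_gt0.
Qed.

HB.instance Definition _ := Lmodule_isNormed.Build R[i] antidual
  antidual_normD antidual_normZ antidual_norm0.

End Antidual.

Section Scale.
Variables (R : realType) (H : hilbertType R) (T : positive_operator H).
Local Notation S := (A0half T).
Local Notation Hhalf := (Hhalf T).

(* H_{-1/2}, the dual of H_{1/2} with respect to the pivot space H: the pairing
   <f, z> is [f z], and H is embedded by h |-> <h, .>. *)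
Definition Hmhalf := antidual Hhalf.

HB.instance Definition _ := NormedModule.on Hmhalf.

Lemma pivot_subproof (h : H) :
  antidual_pred ((fun z => inner h (hval z)) : Hhalf -> R[i]^o).
Proof.
apply/asboolP; split=> [a x y|].
  by rewrite hvalD hvalZ innerDr innerZr.
have [M M0 SM] := A0half_bounded_below T.
exists (complex.Re `|h| * M) => z.
rewrite realCM ReN -mulrA (le_trans (CauchySchwarz_inner _ _))//.
by rewrite ler_wpM2l// SM//; exact: hval_dom.
Qed.

Definition pivot (h : H) : Hmhalf := Antidual (pivot_subproof h).

Lemma A0ext_subproof (z : Hhalf) :
  antidual_pred ((fun w => inner (S (hval z)) (S (hval w))) : Hhalf -> R[i]^o).
Proof.
apply/asboolP; split=> [a x y|].
  by rewrite hvalD hvalZ op_lin ?innerDr ?innerZr//; exact: hval_dom.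
exists (complex.Re `|S (hval z)|) => w.
by rewrite ReN (le_trans (CauchySchwarz_inner _ _)).
Qed.

(* The extension of A_0 to a bounded operator H_{1/2} -> H_{-1/2}; see
   [A0ext_unique]. *)
Definition A0ext (z : Hhalf) : Hmhalf := Antidual (A0ext_subproof z).

Lemma pivotE h z : pivot h z = inner h (hval z).
Proof. by []. Qed.

Lemma A0ext_innerE z w : A0ext z w = inner (S (hval z)) (S (hval w)).
Proof. by []. Qed.

Lemma pivot_is_linear : linear pivot.
Proof.
move=> a g h; apply: antidual_eq => z.
by rewrite antidualDE antidualZE !pivotE innerDl innerZl.
Qed.

HB.instance Definition _ :=
  GRing.isLinear.Build R[i] H Hmhalf _ pivot pivot_is_linear.

Lemma A0ext_is_linear : linear A0ext.
Proof.
move=> a x y; apply: antidual_eq => z.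
rewrite antidualDE antidualZE !A0ext_innerE hvalD hvalZ.
rewrite op_lin; try exact: hval_dom.
by rewrite innerDl innerZl.
Qed.

HB.instance Definition _ :=
  GRing.isLinear.Build R[i] Hhalf Hmhalf _ A0ext A0ext_is_linear.

Lemma dense_dist (A : set H) (x : H) (e : R) : dense A -> 0 < e ->
  exists2 y, A y & `|x - y| < e%:C.
Proof.
move=> dA e0; have e0' : 0 < e%:C by rewrite ltcR.
have [y [xy Ay]] := dA (ball x e%:C) (ex_intro _ _ (ballxx _ e0'))
  (ball_open x e%:C).
by exists y => //; move: xy; rewrite -ball_normE.
Qed.

Lemma pivot_inj : injective pivot.
Proof.
move=> g h gh; apply/eqP; rewrite -subr_eq0; apply/negP => gh0.
have nz : 0 < `|g - h| by rewrite normr_gt0; apply/negP.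
have nzR : 0 < complex.Re `|g - h| by rewrite -ltcR ReN.
have [y dy] := dense_dist (g - h) (@A0half_dense _ _ T) nzR.
have /asboolP dy' := dy.
have : inner (g - h) y = 0.
  have /(congr1 (fun f : Hmhalf => f (MkHhalf dy'))) /= := gh.
  by rewrite innerDl innerNl => ->; rewrite subrr.
move=> ghy; rewrite ReN => /lt_geF; rewrite -(ler_pM2l nz) -expr2.
have E : `|g - h| ^+ 2 = inner (g - h) (g - h - y).
  by rewrite [RHS]innerDr innerNr ghy subr0 inner_norm.
rewrite E (le_trans (real_ler_norm _)) ?CauchySchwarz_inner//.
by rewrite -E rpredX// normr_real.
Qed.

Lemma A0ext_bounded : bounded_operator A0ext.
Proof.
exists 1 => z; rewrite mul1r Hhalf_normE -[leRHS]ReN lecR.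
apply: dual_norm_le => w w1.
rewrite ReN (le_trans (CauchySchwarz_inner _ _))//.
by rewrite ler_piMr.
Qed.

Lemma A0extE (z : Hhalf) : dom T (hval z) -> A0ext z = pivot (T (hval z)).
Proof.
have [_ _ dA eA] := A0half_sqrt T.
move=> dz; have [dz1 dz2] := (dA _).1 dz.
apply: antidual_eq => w; rewrite pivotE A0ext_innerE eA//.
by apply/esym; rewrite A0half_sym//; exact: hval_dom.
Qed.

Lemma A0ext_unique (B : {linear Hhalf -> Hmhalf}) : bounded_operator B ->
  (forall z, dom T (hval z) -> B z = pivot (T (hval z))) -> B =1 A0ext.
Proof.
have [_ _ dA eA] := A0half_sqrt T.
move=> [M BM] BA z; have [N AN] := A0ext_bounded.
apply/eqP; rewrite -subr_eq0 -normr_le0.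
have K0 : 0 < `|M + N| + 1 by rewrite ltr_wpDl.
suff bnd e : 0 < e -> `|B z - A0ext z| <= (e * (`|M + N| + 1))%:C.
  rewrite -ReN lecR; apply/ler_addgt0Pr => e e0; rewrite add0r -lecR ReN.
  rewrite -[e](@divfK _ (`|M + N| + 1)) ?gt_eqF//.
  by apply: bnd; rewrite divr_gt0.
move=> e0; have [v dv zv] := dense_dist (S (hval z)) (@A0half_dense _ _ T) e0.
have [u du Su] := A0half_surj T v.
have /asboolP du' := du; pose w : Hhalf := MkHhalf du'.
have dw : dom T (hval w) by apply/dA; rewrite Su.
have -> : B z - A0ext z = B (z - w) - A0ext (z - w).
  have -> : A0ext (z - w) = A0ext z - A0ext w by exact: (raddfB A0ext).
  have -> : B (z - w) = B z - B w by exact: (raddfB B).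
  by rewrite (BA _ dw) (A0extE dw) opprB addrA addrNK.
have nzw : `|z - w| = `|S (hval z) - v|.
  rewrite Hhalf_normE -scaleN1r hvalD hvalZ scaleN1r opB ?Su//; exact: hval_dom.
apply: (@le_trans _ _ ((M + N)%:C * `|z - w|)).
  by rewrite (le_trans (ler_normB _ _))// realCD mulrDl lerD.
apply: (@le_trans _ _ ((`|M + N| + 1)%:C * `|z - w|)).
  by rewrite ler_wpM2r// lecR (le_trans (ler_norm _))// lerDl.
by rewrite mulrC realCM nzw ler_wpM2r ?(ltW zv)// lecR ltW.
Qed.

(* On H, the norm of H_{-1/2} is ||A_0^{-1/2} h||. *)
Lemma pivot_norm (x : H) : dom S x -> `|pivot (S x)| = `|x|.
Proof.
move=> dx; apply/eqP; rewrite eq_le; apply/andP; split.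
  rewrite -[leRHS]ReN lecR; apply: dual_norm_le => w w1.
  rewrite ReN pivotE A0half_sym//; last exact: hval_dom.
  by rewrite (le_trans (CauchySchwarz_inner _ _))// ler_piMr.
have [->|x0] := eqVneq x 0; first by rewrite normr0.
have nx0 : 0 < `|x| by rewrite normr_gt0.
have [u du Su] := A0half_surj T x.
have /asboolP du' := du; pose w : Hhalf := MkHhalf du'.
have nw : `|w| = `|x| by rewrite Hhalf_normE Su.
have := antidual_normM (pivot (S x)) w.
rewrite pivotE A0half_sym// Su inner_norm nw normrX normr_id expr2.
by rewrite ler_pM2r.
Qed.

Section SystemOperator.
Variable D : {linear Hhalf -> Hmhalf}.

(* Inverses of the embeddings of H_{1/2} into H and of H into H_{-1/2}. *)
Definition to_Hhalf (x : H) : Hhalf := insubd (0 : Hhalf) x.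
Definition to_H (f : Hmhalf) : H := xget 0 [set h | pivot h = f].

Lemma to_HhalfK (z : Hhalf) : to_Hhalf (hval z) = z.
Proof. by rewrite /to_Hhalf -[hval z]/(val z) valKd. Qed.

Lemma hval_to_Hhalf (x : H) : dom S x -> hval (to_Hhalf x) = x.
Proof. by move=> dx; rewrite insubdK//; apply/asboolP. Qed.

Lemma to_HK (h : H) : to_H (pivot h) = h.
Proof.
apply: pivot_inj; rewrite /to_H.
by apply: (@xgetPex _ 0 [set g | pivot g = pivot h]); exists h.
Qed.

Definition system_dom : set (Hhalf * H) :=
  [set p | dom S p.2 /\ range pivot (A0ext p.1 + D (to_Hhalf p.2))].

(* (z, w) |-> (w, - (A_0 z + D w)) *)
Definition system_op (p : Hhalf * H) : Hhalf * H :=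
  (to_Hhalf p.2, - to_H (A0ext p.1 + D (to_Hhalf p.2))).

Lemma system_dom0 : system_dom 0.
Proof.
split; first exact: dom0.
have -> : to_Hhalf (0 : Hhalf * H).2 = 0 by exact: (to_HhalfK 0).
by exists 0 => //; rewrite !raddf0 addr0.
Qed.

Lemma system_lin_aux a (p q : Hhalf * H) : dom S p.2 -> dom S q.2 ->
  A0ext (a *: p + q).1 + D (to_Hhalf (a *: p + q).2) =
  a *: (A0ext p.1 + D (to_Hhalf p.2)) + (A0ext q.1 + D (to_Hhalf q.2)) /\
  to_Hhalf (a *: p + q).2 = a *: to_Hhalf p.2 + to_Hhalf q.2.
Proof.
move=> dp dq.
have E : to_Hhalf (a *: p + q).2 = a *: to_Hhalf p.2 + to_Hhalf q.2.
  rewrite -[RHS]to_HhalfK hvalD hvalZ !hval_to_Hhalf//.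
split=> //; rewrite E.
have -> : A0ext (a *: p + q).1 = a *: A0ext p.1 + A0ext q.1.
  exact: A0ext_is_linear.
have -> : D (a *: to_Hhalf p.2 + to_Hhalf q.2) =
    a *: D (to_Hhalf p.2) + D (to_Hhalf q.2) by exact: linearP.
by rewrite scalerDr addrACA.
Qed.

Lemma system_dom_lin a p q :
  system_dom p -> system_dom q -> system_dom (a *: p + q).
Proof.
move=> [dp [g _ gE]] [dq [h _ hE]]; split; first exact: dom_lin.
by have [-> _] := system_lin_aux a dp dq; rewrite -gE -hE -pivot_is_linear;
  exists (a *: g + h).
Qed.

Lemma system_op_lin a p q : system_dom p -> system_dom q ->
  system_op (a *: p + q) = a *: system_op p + system_op q.
Proof.
move=> [dp [g _ gE]] [dq [h _ hE]]; rewrite /system_op.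
have [-> ->] := system_lin_aux a dp dq; rewrite -gE -hE -pivot_is_linear !to_HK.
by congr pair; rewrite /= scalerN opprD.
Qed.

(* The operator [0, I; -A_0, -D]. The library norm of the product
   H_{1/2} x H is the maximum of the two norms; it is equivalent to the
   Hilbert space norm, hence gives the same spectrum. *)
Definition system_operator : operator (Hhalf * H)%type (Hhalf * H)%type :=
  Operator system_dom0 system_dom_lin system_op_lin.

Lemma system_operatorP (z w : Hhalf) (h : H) : pivot h = A0ext z + D w ->
  dom system_operator (z, hval w) /\ system_operator (z, hval w) = (w, - h).
Proof.
move=> hE; have dw := hval_dom w; split=> /=.
  by split=> //=; rewrite to_HhalfK; exists h.
by rewrite /system_op /= to_HhalfK -hE to_HK.
Qed.

Local Notation nonzero := [set z : Hhalf | z != 0].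

(* If H is the zero space these are +oo, -oo, +oo, +oo; replacing +oo by
   [fine +oo = 0] in a denominator is then harmless, since x / 0 = 0. *)
Definition damping_beta : \bar R :=
  ereal_inf [set (complex.Re (D z z) / rnorm (hval z) ^+ 2)%:E | z in nonzero].

Definition damping_gamma : \bar R :=
  ereal_sup [set (complex.Re (D z z) / rnorm (hval z) ^+ 2)%:E | z in nonzero].

Definition damping_delta : \bar R :=
  ereal_inf [set (complex.Re (D z z) / rnorm z ^+ 2)%:E | z in nonzero].

Definition damping_mu : \bar R :=
  ereal_inf [set (complex.Re (D z z) / (rnorm (hval z) * rnorm z))%:E
            | z in nonzero].

End SystemOperator.

End Scale.

Section Bounds.
Variables (R : realType) (k : R).

Definition h_i (beta t : R) : \bar R :=
  if t < beta / 2 then ((1 - 2 / beta * t)^-1 * (k * t))%:E else +oo%E.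

Definition k_mu_sq (mu : R) : R :=
  2 / mu ^+ 2 + (k ^+ 2 - 1) / 2 +
  Num.sqrt ((2 / mu ^+ 2 + (k ^+ 2 - 1) / 2) ^+ 2 + k ^+ 2).

Definition k_mu (mu : R) : R := Num.sqrt (k_mu_sq mu).

Definition h_ii (mu t : R) : R := k_mu mu * t.

Definition h_iii_sol (delta t : R) : set R :=
  [set y | 0 <= y /\ (y ^+ 2 + t ^+ 2) * (y - k * t) = 2 / delta * t * y].

End Bounds.

Definition is_largest (R : realType) (A : set R) (y : R) : Prop :=
  A y /\ ubound A y.

(* Main.v *)
Require Import Defs.
From HB Require Import structures.
From mathcomp Require Import all_boot all_order all_algebra.
From mathcomp Require Import sesquilinear complex.
From mathcomp Require Import all_classical all_reals all_analysis.
From mathcomp Require Import ring lra.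
Import Order.TTheory GRing.Theory Num.Theory.
Import numFieldNormedType.Exports.
Local Open Scope classical_set_scope.
Local Open Scope complex_scope.
Local Open Scope ring_scope.

Set Implicit Arguments.
Unset Strict Implicit.
Unset Printing Implicit Defensive.

(** Why the theorem holds. Eliminating the second component from the resolvent
    equation turns [A - l] into the pencil [l^2 + l D + A_0], a bounded map from
    [H_{1/2}] to [H_{-1/2}] with quadratic form
      [l^2 |z|^2 + l (D z, z) + |z|_{1/2}^2].
    If the modulus of this form is at least [c |z|_{1/2}^2] for some [c > 0],
    which is called [coercive] below, the Lax-Milgram theorem makes the pencil
    bijective, and [l] is a resolvent point ([coercive_resolvent]). The point is
    that Lax-Milgram needs only a bound on the modulus, not on a real part, so
    no connectedness or Fredholm argument is required. It is derived from the
    projection theorem, applied once to represent functionals ([riesz]) and once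
    to show that the range has no orthogonal complement ([lax_milgram]); the
    isometry [A_0^(1/2)] of [H_{1/2}] onto [H] carries it over to the pencil.

    Let [l] be a spectral point. It is nonzero, and the pencil is not coercive
    at [l], so there are [z] with [|z|_{1/2} = 1] and an arbitrarily small value
    of the form. Put [a = |z|^2], [t = - Re l], [y = Im l] and [s = |l|^-2];
    dividing the form by [l] shows that, up to a small error,
      [Re (D z, z) = t (a + s)] and [Im (D z, z) = y (s - a)].
    As [a] ranges over a bounded interval, a compactness argument gives an [a]
    for which these two numbers exactly satisfy every closed constraint that is
    known for [(D z, z)] ([spectrum_witness]). Those constraints are the sector
    condition, extended from [D(A_0)] to [H_{1/2}] by density ([sector_half]),
    which yields [|y| |s - a| <= k t (a + s)], and one of
      [beta a <= t (a + s)], [mu sqrt a <= t (a + s)], [delta <= t (a + s)].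
    They force [t > 0] ([witness_left_half_plane]), and eliminating [a] from
    them gives exactly the curves [h_i], [h_ii], [h_iii] ([region_i],
    [region_ii], [region_iii]). For [Re l < - gamma] the real part of the form
    divided by [l] is negative, so the pencil is coercive ([coercive_left]). *)

(** * Real-valued norms *)

Section Magnitude.
Variable R : realType.

(** The real number behind the [R[i]]-valued norm. It agrees with [rnorm], but
    also applies to complex scalars, so that all estimates can be made in [R],
    whose order is total. *)
Definition mag (W : normedZmodType R[i]) (x : W) : R := complex.Re `|x|.

Lemma magE (W : normedZmodType R[i]) (x : W) : (mag x)%:C = `|x|.
Proof. exact: ReN. Qed.

Lemma mag_le (W W' : normedZmodType R[i]) (x : W) (y : W') :
  (mag x <= mag y) = (`|x| <= `|y|).
Proof. by rewrite -lecR !magE. Qed.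

Lemma mag_ge0 (W : normedZmodType R[i]) (x : W) : 0 <= mag x.
Proof. by rewrite -lecR magE normr_ge0. Qed.

Lemma mag0 (W : normedZmodType R[i]) : mag (0 : W) = 0.
Proof. by rewrite /mag normr0. Qed.

Lemma magN (W : normedZmodType R[i]) (x : W) : mag (- x) = mag x.
Proof. by rewrite /mag normrN. Qed.

Lemma mag_distC (W : normedZmodType R[i]) (x y : W) : mag (x - y) = mag (y - x).
Proof. by rewrite /mag distrC. Qed.

Lemma magD (W : normedZmodType R[i]) (x y : W) : mag (x + y) <= mag x + mag y.
Proof. by rewrite -lecR realCD !magE ler_normD. Qed.

Lemma mag_dist_trans (W : normedZmodType R[i]) (x y z : W) :
  mag (x - z) <= mag (x - y) + mag (y - z).
Proof. by rewrite (_ : x - z = (x - y) + (y - z)) ?magD// addrA subrK. Qed.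

Lemma mag_eq0 (W : normedZmodType R[i]) (x : W) : (mag x == 0) = (x == 0).
Proof. by rewrite -(inj_eq (@complexI _)) magE normr_eq0. Qed.

Lemma mag_gt0 (W : normedZmodType R[i]) (x : W) : (0 < mag x) = (x != 0).
Proof. by rewrite lt0r mag_eq0 mag_ge0 andbT. Qed.

Lemma magZ (V : normedModType R[i]) (a : R[i]) (x : V) :
  mag (a *: x) = mag a * mag x.
Proof. by apply: (@complexI R); rewrite realCM !magE normrZ. Qed.

Lemma magM (a b : R[i]) : mag (a * b) = mag a * mag b.
Proof. by apply: (@complexI R); rewrite realCM !magE normrM. Qed.

Lemma mag_sqr (a : R[i]) : mag a ^+ 2 = complex.Re a ^+ 2 + complex.Im a ^+ 2.
Proof. by rewrite /mag normc_def/= sqr_sqrtr// addr_ge0 ?sqr_ge0. Qed.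

Lemma mag_conj (a : R[i]) : mag a^*%R = mag a.
Proof. by rewrite /mag norm_conjC. Qed.

Lemma Re_le_mag (a : R[i]) : `|complex.Re a| <= mag a.
Proof.
by rewrite -ler_sqr ?nnegrE ?mag_ge0// mag_sqr real_normK ?num_real// lerDl sqr_ge0.
Qed.

Lemma Im_le_mag (a : R[i]) : `|complex.Im a| <= mag a.
Proof.
by rewrite -ler_sqr ?nnegrE ?mag_ge0// mag_sqr real_normK ?num_real// lerDr sqr_ge0.
Qed.

Lemma ReD (a b : R[i]) : complex.Re (a + b) = complex.Re a + complex.Re b.
Proof. by case: a b => [? ?] []. Qed.

Lemma ReN_opp (a : R[i]) : complex.Re (- a) = - complex.Re a.
Proof. by case: a. Qed.

Lemma ImD (a b : R[i]) : complex.Im (a + b) = complex.Im a + complex.Im b.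
Proof. by case: a b => [? ?] []. Qed.

Lemma ReM (a b : R[i]) : complex.Re (a * b) =
  complex.Re a * complex.Re b - complex.Im a * complex.Im b.
Proof. by case: a b => [? ?] []. Qed.

Lemma ImM (a b : R[i]) : complex.Im (a * b) =
  complex.Re a * complex.Im b + complex.Im a * complex.Re b.
Proof. by case: a b => [? ?] []. Qed.

Lemma Re_conj (a : R[i]) : complex.Re a^*%R = complex.Re a.
Proof. by case: a. Qed.

Lemma Im_conj (a : R[i]) : complex.Im a^*%R = - complex.Im a.
Proof. by case: a. Qed.

Lemma boundedP (V W : normedModType R[i]) (f : V -> W) :
  bounded_operator f -> exists2 M : R, 0 <= M & forall x, mag (f x) <= M * mag x.
Proof.
move=> [M fM]; exists `|M| => // x.
rewrite (@le_trans _ _ (M * mag x))//; last by rewrite ler_wpM2r ?mag_ge0// ler_norm.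
by rewrite -lecR realCM !magE.
Qed.

End Magnitude.

(** * Projection, Riesz representation and the Lax-Milgram theorem *)

Section HilbertTheory.
Variables (R : realType) (H : hilbertType R).
Implicit Types (x y u v w : H) (V : set H).

Lemma Re_inner_self x : complex.Re (inner x x) = mag x ^+ 2.
Proof. by rewrite inner_norm -magE -rmorphXn. Qed.

Lemma mag_inner x y : mag (inner x y) <= mag x * mag y.
Proof. by rewrite -lecR realCM !magE CauchySchwarz_inner. Qed.

Lemma magD_sqr x y :
  mag (x + y) ^+ 2 = mag x ^+ 2 + 2 * complex.Re (inner x y) + mag y ^+ 2.
Proof.
rewrite -!Re_inner_self innerDl !innerDr (innerC y x) !ReD Re_conj; ring.
Qed.

Lemma parallelogram x y :
  mag (x + y) ^+ 2 + mag (x - y) ^+ 2 = 2 * mag x ^+ 2 + 2 * mag y ^+ 2.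
Proof. by rewrite !magD_sqr innerNr ReN_opp magN; ring. Qed.

(** Completeness in the form used twice below: the sets [Z e] generate a Cauchy
    filter, and its limit is the point [p]. *)
Lemma shrinking_limit (Z : R -> set H) :
  (forall e, 0 < e -> Z e !=set0) ->
  (forall e e', e <= e' -> Z e `<=` Z e') ->
  (forall n, 0 < n -> exists2 e, 0 < e & forall x y, Z e x -> Z e y -> mag (x - y) < n) ->
  exists p, forall n, 0 < n -> exists2 e, 0 < e & forall y, Z e y -> mag (p - y) < n.
Proof.
move=> Z0 Zmono Zdiam.
pose F := filter_from [set e : R | 0 < e] Z.
have FF : Filter F.
  apply: filter_from_filter; first by exists 1 => /=.
  move=> e e' /= e0 e'0; exists (Num.min e e') => /=; first by rewrite lt_min e0.
  by move=> x Zx; split; apply: Zmono Zx; rewrite ge_min lexx ?orbT.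
have PF : ProperFilter F by apply: filter_from_proper => e; exact: Z0.
have /cauchy_cvg /cvg_ex[p Fp] : cauchy F.
  apply: cauchy_exP => e e0.
  have eE : e = (complex.Re e)%:C by rewrite RRe_real// ger0_real// ltW.
  have {}e0 : 0 < complex.Re e by rewrite -ltcR -eE.
  have [e' e'0 He'] := Zdiam _ e0; have [x Zx] := Z0 _ e'0.
  exists x, e' => // y Zy; rewrite -ball_normE /=.
  by rewrite eE -magE ltcR He'.
exists p => n n0; have nC : 0 < n%:C by rewrite ltcR.
have [e e0 Ze] := Fp _ (nbhsx_ballx p _ nC).
exists e => // y /Ze; rewrite -ball_normE /=.
by rewrite -magE ltcR.
Qed.

Definition is_subspace V : Prop :=
  V 0 /\ forall a x y, V x -> V y -> V (a *: x + y).

Definition is_closed V : Prop :=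
  forall x, (forall n : R, 0 < n -> exists2 v, V v & mag (x - v) < n) -> V x.

(** The first-variation argument: if moving from [u] along [v] never shortens
    [u], then [u] is orthogonal to [v]. *)
Lemma min_orthogonal u v :
  (forall a, mag u <= mag (u + a *: v)) -> inner u v = 0.
Proof.
move=> umin; pose c := inner u v; pose m := mag v ^+ 2.
have m0 : 0 <= m by rewrite sqr_ge0.
have m1 : 0 < 1 + m by rewrite ltr_wpDr.
pose s : R := (1 + m)^-1.
have s0 : 0 < s by rewrite invr_gt0.
have sm : s * m < 1 by rewrite mulrC ltr_pdivrMr// mul1r ltrDr.
have := umin (- s%:C * c).
rewrite -ler_sqr ?nnegrE ?mag_ge0// magD_sqr magZ innerZr magM.
have -> : mag (- s%:C) = s.
  by rewrite magN; apply: (@complexI R); rewrite magE ger0_norm// lecR ltW.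
have -> : complex.Re ((- s%:C * c)^*%R * inner u v) = - s * mag c ^+ 2.
  rewrite -/c mag_sqr; case: (c) => a b /=; ring.
rewrite exprMn -/m => h.
have : 0 <= mag c ^+ 2 * (s * m - 2).
  rewrite -(pmulr_rge0 _ s0); move: h; rewrite -subr_ge0.
  by congr (0 <= _); rewrite /m; ring.
rewrite nmulr_lge0; last by rewrite subr_lt0 (lt_trans sm)// ltr1n.
move=> c0; apply/eqP; rewrite -mag_eq0 -sqrf_eq0 eq_le c0 sqr_ge0//.
Qed.

(** A minimising sequence for the distance from [x] is Cauchy by the
    parallelogram identity; [x] minus its limit is the required vector. *)
Lemma orthogonal_vector V x : is_subspace V -> is_closed V -> ~ V x ->
  exists2 u, u != 0 & forall v, V v -> inner u v = 0.
Proof.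
move=> [V0 Vlin] Vcl Vx.
have VD v w : V v -> V w -> V (v + w).
  by move=> Vv Vw; rewrite -[v]scale1r; exact: Vlin.
have VZ a v : V v -> V (a *: v) by move=> Vv; rewrite -[_ *: _]addr0; exact: Vlin.
pose E := [set mag (x - v) ^+ 2 | v in V].
have hE : has_inf E.
  split; first by exists (mag (x - 0) ^+ 2), 0.
  by exists 0 => _ [v _ <-]; exact: sqr_ge0.
have dE v : V v -> inf E <= mag (x - v) ^+ 2.
  by move=> Vv; apply: ge_inf; [case: hE | exists v].
pose Z (e : R) := [set v | V v /\ mag (x - v) ^+ 2 < inf E + e].
have Zdiam e v w : Z e v -> Z e w -> mag (v - w) ^+ 2 < 4 * e.
  move=> [Vv vE] [Vw wE].
  have := parallelogram (x - v) (x - w).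
  have -> : x - v + (x - w) = 2 *: (x - 2^-1 *: (v + w)).
    rewrite scalerBr scalerA mulfV ?pnatr_eq0// scale1r scaler_nat mulr2n.
    by rewrite opprD addrACA.
  have -> : x - v - (x - w) = - (v - w) by rewrite !opprB addrC addrA subrK.
  rewrite magN magZ exprMn.
  have -> : mag (2 : R[i]) = 2.
    by apply: (@complexI R); rewrite magE normr_nat rmorph_nat.
  have := dE _ (VZ 2^-1 _ (VD _ _ Vv Vw)).
  move: vE wE; lra.
have [p pZ] : exists p, forall n, 0 < n ->
    exists2 e, 0 < e & forall y, Z e y -> mag (p - y) < n.
  apply: shrinking_limit.
  - move=> e e0; have [_ [v Vv <-] vE] := inf_adherent e0 hE.
    by exists v.
  - by move=> e e' ee' v [Vv vE]; split=> //; apply: lt_le_trans vE _; rewrite lerD2l.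
  - move=> n n0; exists (n ^+ 2 / 4); first by rewrite divr_gt0// exprn_gt0.
    move=> v w Zv Zw; rewrite -ltr_sqr ?nnegrE ?mag_ge0 ?ltW//.
    by apply: lt_le_trans (Zdiam _ _ _ Zv Zw) _; rewrite mulrC divfK// pnatr_eq0.
have Znear n : 0 < n -> exists2 v, V v & mag (p - v) < n /\ mag (x - v) ^+ 2 < inf E + n.
  move=> n0; have [e e0 Ze] := pZ n n0.
  have [|_ [v Vv <-] vE] := @inf_adherent _ E (Num.min e n) _ hE; first by rewrite lt_min e0.
  exists v => //; split; last by apply: lt_le_trans vE _; rewrite lerD2l ge_min lexx orbT.
  by apply: Ze; split=> //; apply: lt_le_trans vE _; rewrite lerD2l ge_min lexx.
have Vp : V p by apply: Vcl => n /Znear[v Vv [pv _]]; exists v.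
have pE : mag (x - p) ^+ 2 <= inf E.
  apply/ler_addgt0Pr => e e0.
  pose m := mag (x - p).
  have m0 : 0 <= m by exact: mag_ge0.
  pose n := Num.min 1 (e / (2 * m + 2)).
  have n0 : 0 < n by rewrite lt_min ltr01 divr_gt0// ltr_wpDl// mulr_ge0.
  have [v Vv [pv xv]] := Znear n n0.
  have : m <= mag (x - v) + n.
    by apply: le_trans (mag_dist_trans x v p) _; rewrite lerD2l mag_distC ltW.
  have nn : n * (2 * m + 2) <= e.
    by rewrite -ler_pdivlMr ?ltr_wpDl ?mulr_ge0// ge_min lexx orbT.
  have n1 : n <= 1 by rewrite ge_min lexx.
  move=> mn; rewrite -/m; have := mag_ge0 (x - v).
  have [mn'|/ltW mn'] := leP n m; last first.
    by have := dE _ Vv; have := sqr_ge0 (mag (x - v)); nra.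
  nra.
exists (x - p); first by rewrite subr_eq0; apply/eqP => xp; apply: Vx; rewrite xp.
move=> v Vv; apply: min_orthogonal => a.
rewrite -ler_sqr ?nnegrE ?mag_ge0// (le_trans pE)//.
have -> : x - p + a *: v = x - (p - a *: v) by rewrite opprB addrCA addrC.
by apply: dE; rewrite addrC -scaleNr; exact: Vlin.
Qed.

Definition conj_linear (f : H -> R[i]) : Prop :=
  forall a x y, f (a *: x + y) = a^*%R * f x + f y.

(** A nonzero vector orthogonal to the kernel of [f], suitably scaled,
    represents [f]. *)
Lemma riesz (f : H -> R[i]) (M : R) : conj_linear f ->
  (forall x, mag (f x) <= M * mag x) -> exists u, forall v, f v = inner u v.
Proof.
move=> flin fM.
have f0 : f 0 = 0.
  by apply/eqP; rewrite -mag_eq0 eq_le mag_ge0 andbT; have := fM 0; rewrite mag0 mulr0.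
have [f_eq0|] := pselect (forall x, f x = 0).
  by exists 0 => v; rewrite f_eq0 linear0l.
move=> /existsNP[x fx].
pose V : set H := [set v | f v = 0].
have fB y z : f (y - z) = f y - f z.
  rewrite addrC -scaleN1r flin rmorphN1 mulN1r addrC//.
have Vsub : is_subspace V.
  by split=> // a y z; rewrite /V/= flin => -> ->; rewrite mulr0 addr0.
have Vcl : is_closed V.
  move=> y ycl; apply/eqP; rewrite -mag_eq0 eq_le mag_ge0 andbT.
  have M1 : 0 < `|M| + 1 by rewrite ltr_wpDl.
  apply/ler_addgt0Pr => e e0; rewrite add0r.
  have [|v Vv yv] := ycl (e / (`|M| + 1)); first by rewrite divr_gt0.
  have -> : f y = f (y - v) by rewrite fB [f v]Vv subr0.
  apply: le_trans (fM _) _; move: yv; rewrite ltr_pdivlMr// => yv.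
  by have := ler_norm M; have := mag_ge0 (y - v); nra.
have [u u0 uV] := orthogonal_vector Vsub Vcl fx.
have fu : f u != 0.
  apply/eqP => Vu; move/eqP: u0; apply; apply/eqP.
  by rewrite -mag_eq0 -sqrf_eq0 -Re_inner_self uV.
pose N := inner u u.
have N0 : N != 0 by rewrite /N inner_norm sqrf_eq0 normr_eq0.
exists ((f u / N) *: u) => w; rewrite innerZl.
pose c := (f w / f u)^*%R.
have : inner u (w - c *: u) = 0.
  apply: uV; rewrite /V/= fB -[c *: u]addr0 flin f0 addr0 /c conjCK divfK//.
  by rewrite subrr.
rewrite innerDr innerNr innerZr /c conjCK => /eqP.
by rewrite subr_eq0 -/N => /eqP ->; field; rewrite fu N0.
Qed.

(** Only a lower bound on the modulus of the quadratic form is assumed: it makes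
    the range closed, and it forbids a nonzero vector orthogonal to the range. *)
Lemma lax_milgram (a : H -> H -> R[i]) (M c : R) :
  (forall v, linear (a^~ v : H -> R[i]^o)) -> (forall x, conj_linear (a x)) ->
  (forall x v, mag (a x v) <= M * mag x * mag v) ->
  0 < c -> (forall x, c * mag x ^+ 2 <= mag (a x x)) ->
  forall f : H -> R[i], conj_linear f ->
    (exists N : R, forall v, mag (f v) <= N * mag v) ->
  exists x, forall v, a x v = f v.
Proof.
move=> alinl alinr aM c0 ac f flin [N fN].
have [u fu] := riesz flin fN; suff [x xu] : exists x, forall v, a x v = inner u v.
  by exists x => v; rewrite xu fu.
have aBl x y v : a (x - y) v = a x v - a y v.
  by rewrite addrC -scaleN1r alinl scaleN1r addrC.
pose W : set H := [set w | exists x, forall v, a x v = inner w v].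
have aW w w' x x' : (forall v, a x v = inner w v) -> (forall v, a x' v = inner w' v) ->
    c * mag (x - x') <= mag (w - w').
  move=> xw xw'; have [->|xx'] := eqVneq x x'; first by rewrite subrr mag0 mulr0 mag_ge0.
  have x0 : 0 < mag (x - x') by rewrite mag_gt0 subr_eq0.
  rewrite -(ler_pM2r x0) -mulrA -expr2 (le_trans (ac _))//.
  by rewrite aBl xw xw' -innerNl -innerDl mag_inner.
have Wsub : is_subspace W.
  split; first by exists 0 => v; have := alinl v (-1) 0 0;
    rewrite scaler0 addr0 scaleN1r addNr linear0l.
  move=> b w w' [x xw] [x' xw']; exists (b *: x + x') => v.
  by rewrite alinl xw xw' innerDl innerZl.
have Wcl : is_closed W.
  move=> w wcl.
  pose Z (e : R) := [set x | exists2 w', forall v, a x v = inner w' v & mag (w - w') < e].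
  have [p pZ] : exists p, forall n, 0 < n ->
      exists2 e, 0 < e & forall y, Z e y -> mag (p - y) < n.
    apply: shrinking_limit.
    - by move=> e /wcl[w' [x xw'] ww']; exists x, w'.
    - by move=> e e' ee' x [w' xw' ww']; exists w' => //; exact: lt_le_trans ee'.
    - move=> n n0; exists (n * c / 2); first by rewrite divr_gt0// mulr_gt0.
      move=> x x' [w1 xw1 ww1] [w2 xw2 ww2].
      have := aW _ _ _ _ xw1 xw2; have := mag_dist_trans w1 w w2.
      rewrite (mag_distC w1 w) -(ltr_pM2l c0); lra.
  exists p => v; apply/eqP; rewrite -subr_eq0 -mag_eq0 eq_le mag_ge0 andbT.
  apply/ler_addgt0Pr => e e0; rewrite add0r.
  pose K := (`|M| + 1) * (mag v + 1).
  have K0 : 0 < K by rewrite mulr_gt0// ?ltr_wpDl// mag_ge0.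
  have K2 : 0 < 2 * K by exact: mulr_gt0.
  have n0 : 0 < e / (2 * K) by exact: divr_gt0.
  have [d d0 dZ] := pZ _ n0.
  have [|w' [x xw'] ww'] := wcl (Num.min d (e / (2 * K))); first by rewrite lt_min d0.
  move: ww'; rewrite lt_min => /andP[wd wK].
  have px : mag (p - x) < e / (2 * K) by apply: dZ; exists w'.
  have -> : a p v - inner w v = a (p - x) v + inner (w' - w) v.
    by rewrite aBl xw' innerDl innerNl; ring.
  apply: le_trans (magD _ _) _.
  have h1 := aM (p - x) v; have h2 := mag_inner (w' - w) v.
  move: px wK; rewrite !ltr_pdivlMr// => px wK.
  have vK : mag v <= K.
    by rewrite /K; have := mag_ge0 v; have := normr_ge0 M; nra.
  have MK : `|M| * mag v <= K.
    by rewrite /K; have := mag_ge0 v; have := normr_ge0 M; nra.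
  have h3 : M * mag (p - x) * mag v <= K * mag (p - x).
    rewrite -mulrA mulrCA mulrC ler_wpM2r ?mag_ge0//.
    by apply: le_trans MK; rewrite ler_wpM2r ?mag_ge0// ler_norm.
  have h4 : mag (w' - w) * mag v <= mag (w' - w) * K by rewrite ler_wpM2l ?mag_ge0.
  by move: px wK; rewrite (mag_distC w w'); lra.
apply: contrapT => Wu.
have [v v0 vW] := orthogonal_vector Wsub Wcl Wu.
have [w vw] := riesz (alinr v) (aM v).
have : a v v = 0 by rewrite vw innerC vW ?rmorph0//; exists v.
have := ac v; move=> /[swap] ->; rewrite mag0 pmulr_rle0// => v2.
by move: v0; rewrite -mag_eq0 -sqrf_eq0 eq_le v2 sqr_ge0.
Qed.

End HilbertTheory.

(** * The operator pencil and the resolvent set *)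

Section Pencil.
Variables (R : realType) (H : hilbertType R) (T : positive_operator H).
Local Notation S := (A0half T).
Local Notation Hhalf := (Hhalf T).
Local Notation Hmhalf := (Hmhalf T).

Lemma mag_half (z : Hhalf) : mag z = mag (S (hval z)).
Proof. by []. Qed.

Lemma hval_eq0 (z : Hhalf) : (hval z == 0) = (z == 0).
Proof.
apply/eqP/eqP => [z0|->]; first exact/val_inj.
by rewrite -(scale0r (0 : Hhalf)) hvalZ scale0r.
Qed.

Lemma half_embedding_bounded :
  exists2 K : R, 0 < K & forall z : Hhalf, mag (hval z) <= K * mag z.
Proof.
have [K K0 SK] := A0half_bounded_below T; exists K => // z.
by rewrite -lecR realCM !magE SK//; exact: hval_dom.
Qed.

Lemma mag_antidual (f : Hmhalf) (z : Hhalf) : mag (f z) <= mag f * mag z.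
Proof. by rewrite -lecR realCM !magE antidual_normM. Qed.

Lemma mag_inner_half (z w : Hhalf) : mag (inner (S (hval z)) (S (hval w))) <= mag z * mag w.
Proof. exact: mag_inner. Qed.

(** [A_0^(1/2)] is an isometric isomorphism of [H_{1/2}] onto [H]; its inverse
    transfers sesquilinear problems on [H_{1/2}] to the Hilbert space [H]. *)
Lemma half_isometry : exists J : H -> Hhalf,
  [/\ forall u, S (hval (J u)) = u, forall z, J (S (hval z)) = z &
      forall a u v, J (a *: u + v) = a *: J u + J v].
Proof.
have /choice[J SJ] : forall u, exists z : Hhalf, S (hval z) = u.
  move=> u; have [x dx Sx] := A0half_surj T u.
  by have /asboolP dx' := dx; exists (MkHhalf dx').
have Sinj (z w : Hhalf) : S (hval z) = S (hval w) -> z = w.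
  move=> zw; apply/val_inj/eqP; rewrite -subr_eq0; apply/eqP/(A0half_inj (T := T)).
    by apply: domB; exact: hval_dom.
  by rewrite opB ?zw ?subrr//; exact: hval_dom.
exists J; split=> // [z|a u v]; first by apply: Sinj; rewrite SJ.
by apply: Sinj; rewrite SJ hvalD hvalZ op_lin ?SJ//; exact: hval_dom.
Qed.

Variable D : {linear Hhalf -> Hmhalf}.

(** [l^2 + l D + A_0 : H_{1/2} -> H_{-1/2}], obtained by eliminating the second
    component from the resolvent equation of the system. *)
Definition pencil (l : R[i]) (z : Hhalf) : Hmhalf :=
  l ^+ 2 *: pivot T (hval z) + l *: D z + A0ext z.

Lemma pencilE l z w : pencil l z w =
  l ^+ 2 * inner (hval z) (hval w) + l * D z w + inner (S (hval z)) (S (hval w)).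
Proof. by []. Qed.

Lemma pencil_self l z : pencil l z z =
  l ^+ 2 * (mag (hval z) ^+ 2)%:C + l * D z z + (mag z ^+ 2)%:C.
Proof. by rewrite pencilE !inner_norm !rmorphXn/= !magE. Qed.

Lemma pencil_linear l : linear (pencil l).
Proof.
move=> a x y; apply: antidual_eq => w.
rewrite -[RHS]/(a * pencil l x w + pencil l y w).
rewrite !pencilE hvalD hvalZ op_lin; try exact: hval_dom.
by rewrite linearP antidualDE antidualZE !innerDl !innerZl; ring.
Qed.

Definition coercive (l : R[i]) : Prop :=
  exists2 c : R, 0 < c & forall z, c * mag z ^+ 2 <= mag (pencil l z z).

Hypothesis D_bounded : bounded_operator D.

Lemma pencil_bounded l : exists M : R, forall z w, mag (pencil l z w) <= M * mag z * mag w.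
Proof.
have [K K0 zK] := half_embedding_bounded; have [N N0 DN] := boundedP D_bounded.
exists (mag l ^+ 2 * K ^+ 2 + mag l * N + 1) => z w; rewrite pencilE.
have z0 := mag_ge0 z; have w0 := mag_ge0 w; have l0 := mag_ge0 l.
have h1 : mag (l ^+ 2 * inner (hval z) (hval w)) <= mag l ^+ 2 * K ^+ 2 * (mag z * mag w).
  rewrite expr2 !magM -expr2 -mulrA ler_wpM2l ?sqr_ge0//.
  apply: le_trans (mag_inner _ _) _.
  have -> : K ^+ 2 * (mag z * mag w) = (K * mag z) * (K * mag w) by ring.
  by apply: ler_pM; rewrite ?mag_ge0.
have h2 : mag (l * D z w) <= mag l * N * (mag z * mag w).
  rewrite magM -mulrA ler_wpM2l// (le_trans (mag_antidual _ _))//.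
  by rewrite mulrA ler_wpM2r.
have h3 := mag_inner_half z w.
apply: le_trans (magD _ _) _.
have h4 := magD (l ^+ 2 * inner (hval z) (hval w)) (l * D z w).
by move: h1 h2 h3 h4; lra.
Qed.

Lemma pencil_surjective l : coercive l -> forall f : Hmhalf, exists z, pencil l z = f.
Proof.
move=> [c c0 lc] f; have [J [SJ JS Jlin]] := half_isometry.
have [M lM] := pencil_bounded l.
have magJ u : mag (J u) = mag u by rewrite mag_half SJ.
have [||||||x xf] := @lax_milgram _ _ (fun u v => pencil l (J u) (J v)) M c
    _ _ _ c0 _ (fun v => f (J v)).
- by move=> v a x y; rewrite Jlin pencil_linear.
- by move=> x a u v; rewrite Jlin antidual_lin.
- by move=> x v; have := lM (J x) (J v); rewrite !magJ.
- by move=> x; have := lc (J x); rewrite magJ.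
- by move=> a u v; rewrite Jlin antidual_lin.
- by exists (mag f) => v; have := mag_antidual f (J v); rewrite magJ.
by exists (J x); apply: antidual_eq => w; have := xf (S (hval w)); rewrite JS.
Qed.

Lemma mag_pair_ge1 (p : Hhalf * H) : mag p.1 <= mag p.
Proof.
by rewrite mag_le prod_normE comparable_le_max ?lexx// real_comparable ?normr_real.
Qed.

Lemma mag_pair_ge2 (p : Hhalf * H) : mag p.2 <= mag p.
Proof.
by rewrite mag_le prod_normE comparable_le_max ?lexx ?orbT// real_comparable ?normr_real.
Qed.

Lemma mag_pair_le (p : Hhalf * H) : mag p <= mag p.1 + mag p.2.
Proof.
rewrite -lecR realCD !magE prod_normE comparable_ge_max ?real_comparable ?normr_real//.
by rewrite lerDl lerDr !normr_ge0.
Qed.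

Lemma system_domP (p : Hhalf * H) : dom (system_operator D) p ->
  exists w h, [/\ p = (p.1, hval w), pivot T h = A0ext p.1 + D w &
                  system_operator D p = (w, - h)].
Proof.
case: p => z w [/= dw [h _ hE]]; exists (to_Hhalf T w), h.
have wE : hval (to_Hhalf T w) = w by exact: hval_to_Hhalf.
split=> //; first by rewrite wE.
by have := (system_operatorP hE).2; rewrite wE.
Qed.

(** With [(f, g) = (A - l) (z, w)] one has [w = l z + f], and testing the second
    component against [z] bounds the pencil at [z] by [f] and [g]. *)
Lemma coercive_bounded_below l : coercive l ->
  exists M : R, forall p, dom (system_operator D) p ->
    mag p <= M * mag (system_operator D p - l *: p).
Proof.
move=> [c c0 lc].
have [K K0 zK] := half_embedding_bounded; have [N N0 DN] := boundedP D_bounded.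
pose C := (K + mag l * K ^+ 2 + N) / c.
exists (C + K * (mag l * C + 1)) => p /system_domP[w [h [pE hE ->]]].
move: p.1 pE hE => z -> hE {p}.
set q := (w, - h) - l *: (z, hval w).
have q1 : mag (w - l *: z) <= mag q by exact: (mag_pair_ge1 q).
have q2 : mag (- h - l *: hval w) <= mag q by exact: (mag_pair_ge2 q).
set f := w - l *: z in q1; set g := - h - l *: hval w in q2.
have l0 := mag_ge0 l; have z0 := mag_ge0 z; have q0 := mag_ge0 q.
have wE : w = l *: z + f by rewrite /f addrC subrK.
have LE : pencil l z z = - (inner g (hval z) + l * inner (hval f) (hval z) + D f z).
  have hz : inner h (hval z) = inner (S (hval z)) (S (hval z)) + (l * D z z + D f z).
    have := congr1 (fun F : Hmhalf => F z) hE.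
    by rewrite /= wE linearP.
  have hwE : hval w = l *: hval z + hval f by rewrite wE hvalD hvalZ.
  rewrite pencilE /g hwE !(innerDl, innerNl, innerZl) hz; ring.
have zC : mag z <= C * mag q.
  have [->|zn0] := eqVneq z 0.
    rewrite mag0 mulr_ge0//; apply: divr_ge0; last exact: ltW.
    by rewrite !addr_ge0 ?mulr_ge0 ?sqr_ge0// ltW.
  have zp : 0 < mag z by rewrite mag_gt0.
  rewrite /C mulrAC ler_pdivlMr// -(ler_pM2r zp).
  have -> : mag z * c * mag z = c * mag z ^+ 2 by ring.
  apply: le_trans (lc z) _; rewrite LE magN.
  have h1 : mag (inner g (hval z)) <= K * mag q * mag z.
    apply: le_trans (mag_inner _ _) _.
    by rewrite [K * _]mulrC -mulrA; apply: ler_pM; rewrite ?mag_ge0.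
  have h2 : mag (l * inner (hval f) (hval z)) <= mag l * K ^+ 2 * mag q * mag z.
    rewrite magM -[leRHS]mulrA -[leRHS]mulrA ler_wpM2l// (le_trans (mag_inner _ _))//.
    have -> : K ^+ 2 * (mag q * mag z) = K * mag q * (K * mag z) by ring.
    apply: ler_pM; rewrite ?mag_ge0// (le_trans (zK f))//.
    by rewrite ler_wpM2l// ltW.
  have h3 : mag (D f z) <= N * mag q * mag z.
    apply: le_trans (mag_antidual _ _) _; rewrite ler_wpM2r// (le_trans (DN f))//.
    by rewrite ler_wpM2l.
  apply: le_trans (magD _ _) _.
  have h4 := magD (inner g (hval z)) (l * inner (hval f) (hval z)).
  by move: h1 h2 h3 h4; lra.
have wC : mag w <= (mag l * C + 1) * mag q.
  rewrite wE; apply: le_trans (magD _ _) _; rewrite magZ mulrDl mul1r lerD//.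
  by rewrite -mulrA ler_wpM2l.
apply: le_trans (mag_pair_le _) _; rewrite mulrDl lerD//.
by apply: le_trans (zK w) _; rewrite -mulrA ler_wpM2l// ltW.
Qed.

(** Injectivity and boundedness of the inverse are [coercive_bounded_below];
    a preimage of [(f, g)] is obtained by solving the pencil equation for the
    first component and setting [w = l z + f]. *)
Lemma coercive_resolvent l : coercive l -> resolvent_set (system_operator D) l.
Proof.
move=> lc; have [M bM] := coercive_bounded_below lc; split; last first.
  by exists M => p dp; rewrite -!magE -realCM lecR bM.
split=> //.
  move=> p q /set_mem dp /set_mem dq /= pq; apply/eqP; rewrite -subr_eq0 -mag_eq0.
  rewrite eq_le mag_ge0 andbT (le_trans (bM _ (domB dp dq)))// opB//.
  have -> : system_operator D p - system_operator D q - l *: (p - q) =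
      (system_operator D p - l *: p) - (system_operator D q - l *: q).
    by rewrite scalerBr !opprB [X in _ + X]addrC addrACA [X in _ + X]addrC.
  by rewrite pq subrr mag0 mulr0.
move=> [f g] _.
have [z zE] := pencil_surjective lc (- (pivot T g + l *: pivot T (hval f) + D f)).
pose w := l *: z + f; pose h := - g - l *: hval w.
have hE : pivot T h = A0ext z + D w.
  apply: antidual_eq => v.
  have hv : pivot T h v = - inner g (hval v) -
      l * (l * inner (hval z) (hval v) + inner (hval f) (hval v)).
    by rewrite pivotE /h /w hvalD hvalZ !(innerDl, innerNl, innerZl).
  have Dv : D w v = l * D z v + D f v by rewrite /w linearP.
  have zv : l ^+ 2 * inner (hval z) (hval v) + l * D z v + A0ext z v =
      - (inner g (hval v) + l * inner (hval f) (hval v) + D f v).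
    exact: (congr1 (fun F : Hmhalf => F v) zE).
  rewrite hv antidualDE Dv; apply/eqP; rewrite -subr_eq0; apply/eqP.
  move/eqP: zv; rewrite -subr_eq0 => /eqP zv.
  by rewrite -[RHS]oppr0 -zv; ring.
have [dzw eqzw] := system_operatorP hE.
exists (z, hval w); first exact: dzw.
rewrite eqzw; congr pair => /=.
  by rewrite /w addrC addKr.
by rewrite /h opprB opprK addrC addKr.
Qed.

End Pencil.

(** * Spectral points produce limits of the numerical range *)

Section NumericalRange.
Variables (R : realType) (H : hilbertType R) (T : positive_operator H).
Local Notation S := (A0half T).
Local Notation Hhalf := (Hhalf T).
Local Notation Hmhalf := (Hmhalf T).
Variable D : {linear Hhalf -> Hmhalf}.
Hypothesis D_bounded : bounded_operator D.
Local Notation damp z := (complex.Re (D z z)).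

(** [D(A_0)] is dense in [H_{1/2}], because [A_0^(1/2)] maps it onto the dense
    domain of [A_0^(1/2)]; both sides are continuous on [H_{1/2}]. *)
Lemma sector_half (k : R) : 0 <= k ->
  (forall z : Hhalf, dom T (hval z) -> `|complex.Im (D z z)| <= k * damp z) ->
  forall z : Hhalf, `|complex.Im (D z z)| <= k * damp z.
Proof.
move=> k0 sec z; have [N N0 DN] := boundedP D_bounded.
have [J [SJ JS Jlin]] := half_isometry T.
have [_ _ dA _] := A0half_sqrt T.
have z0 := mag_ge0 z.
(* If [|z - y| <= 1], then [(D z, z)] and [(D y, y)] differ by at most
   [N (2 |z| + 1) |z - y|]; the factor [1 + k] accounts for the imaginary and
   the real part. *)
pose C := (1 + k) * N * (2 * mag z + 1) + 1.
have C0 : 0 < C by rewrite ltr_wpDl// !mulr_ge0 ?addr_ge0 ?mulr_ge0.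
apply/ler_addgt0Pr => e e0.
pose n := Num.min 1 (e / C).
have n0 : 0 < n by rewrite lt_min ltr01 divr_gt0.
have [v dv zv] := dense_dist (S (hval z)) (@A0half_dense _ _ T) n0.
pose y := J v.
have dy : dom T (hval y) by apply/dA; split; [exact: hval_dom | rewrite SJ].
have yz : mag (z - y) <= n.
  rewrite mag_half -scaleN1r hvalD hvalZ scaleN1r opB; try exact: hval_dom.
  by rewrite SJ -lecR magE ltW.
have n1 : n <= 1 by rewrite ge_min lexx.
have nC : n * C <= e by rewrite -ler_pdivlMr// ge_min lexx orbT.
have y1 : mag y <= mag z + 1.
  have -> : y = z + - (z - y) by rewrite opprB addrC subrK.
  by rewrite (le_trans (magD _ _))// magN lerD2l (le_trans yz).
have dz : mag (D z z - D y y) <= n * N * (2 * mag z + 1).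
  have -> : D z z - D y y = D (z - y) z + D y (z - y).
    have -> : D (z - y) z = D z z - D y z by rewrite raddfB.
    have -> : D y (z - y) = D y z - D y y.
      by rewrite addrC -scaleN1r antidual_lin rmorphN1; ring.
    ring.
  apply: le_trans (magD _ _) _.
  have h1 : mag (D (z - y) z) <= N * n * mag z.
    apply: le_trans (mag_antidual _ _) _; rewrite ler_wpM2r// (le_trans (DN _))//.
    by rewrite ler_wpM2l.
  have h2 : mag (D y (z - y)) <= N * (mag z + 1) * n.
    apply: le_trans (mag_antidual _ _) _; apply: ler_pM; rewrite ?mag_ge0//.
    by rewrite (le_trans (DN _))// ler_wpM2l.
  by move: h1 h2; lra.
have := sec y dy.
have hI := le_trans (Im_le_mag _) dz; have hR := le_trans (Re_le_mag _) dz.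
move: hI hR; rewrite !ReD !ImD ReN_opp.
have -> : complex.Im (- D y y) = - complex.Im (D y y) by case: (D y y).
rewrite !ler_norml => /andP[I1 I2] /andP[R1 R2] /andP[s1 s2].
have kR : k * (damp y - damp z) <= k * (n * N * (2 * mag z + 1)).
  by rewrite ler_wpM2l//; lra.
have nC' : n * C = (1 + k) * (n * N * (2 * mag z + 1)) + n by rewrite /C; ring.
by apply/andP; split; lra.
Qed.

(** Multiplying the form by the conjugate of [l] isolates the damping, with a
    real factor [N = |l|^2]; the two estimates bound the real and the imaginary
    part of the product by its modulus. *)
Lemma pencil_parts l (z : Hhalf) (N : R) : N = mag l ^+ 2 ->
  `|N * damp z + complex.Re l * (N * mag (hval z) ^+ 2 + mag z ^+ 2)|
    <= mag l * mag (pencil D l z z) /\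
  `|N * complex.Im (D z z) + complex.Im l * (N * mag (hval z) ^+ 2 - mag z ^+ 2)|
    <= mag l * mag (pencil D l z z).
Proof.
move=> NE; rewrite -(mag_conj l) -magM.
have hR := Re_le_mag (l^*%R * pencil D l z z).
have hI := Im_le_mag (l^*%R * pencil D l z z).
split; [apply: le_trans hR | apply: le_trans hI];
  rewrite pencil_self NE mag_sqr !(ReM, ImM, ReD, ImD, Re_conj, Im_conj, expr2) /=;
  rewrite le_eqVlt; apply/orP; left; apply/eqP; congr (`| _ |); ring.
Qed.

Lemma coercive0 : coercive D 0.
Proof.
exists 1 => // z; rewrite mul1r pencil_self expr0n/= !mul0r !add0r.
have := Re_le_mag (mag z ^+ 2)%:C; rewrite /= ger0_norm// sqr_ge0//.
Qed.

(** If the damping is at most [- Re l |z|^2], then by [pencil_parts] the real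
    part of the form times the conjugate of [l] is at most [Re l |z|_{1/2}^2],
    which is negative. *)
Lemma coercive_left l : complex.Re l < 0 ->
  (forall z, damp z <= - complex.Re l * mag (hval z) ^+ 2) -> coercive D l.
Proof.
move=> l0 Dl; have ml : 0 < mag l.
  by rewrite mag_gt0; apply/eqP => l00; move: l0; rewrite l00 ltxx.
exists (- complex.Re l / mag l) => [|z]; first by rewrite divr_gt0// oppr_gt0.
have [/(le_trans _) h _] := pencil_parts z (erefl (mag l ^+ 2)).
rewrite mulrAC ler_pdivrMr// mulrC [leRHS]mulrC mulrC; apply: h.
rewrite -normrN (le_trans _ (ler_norm _))//.
have : mag l ^+ 2 * damp z <= mag l ^+ 2 * (- complex.Re l * mag (hval z) ^+ 2).
  by rewrite ler_wpM2l ?sqr_ge0.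
lra.
Qed.

(** At a spectral point the pencil is not coercive, so normalised vectors almost
    annihilate it; then [(D z, z)] is determined up to a small error by
    [a = |z|^2], and compactness of the range of [a] yields an exact solution.
    Here [s = |l|^-2], and the two inequalities say that
    [p = - Re l (a + s)] and [q = Im l (s - a)], the parts of the limit of
    [(D z, z)], satisfy the constraints imposed on the damping. *)
Lemma spectrum_witness (k : R) (phi : R -> R) l : 0 <= k ->
  (forall z, `|complex.Im (D z z)| <= k * damp z) ->
  continuous phi ->
  (forall z, z != 0 -> phi (mag (hval z) ^+ 2 / mag z ^+ 2) <= damp z / mag z ^+ 2) ->
  spectrum (system_operator D) l ->
  l != 0 /\ exists a, [/\ 0 <= a,
    phi a <= - complex.Re l * (a + (mag l ^+ 2)^-1) &
    `|complex.Im l| * `|(mag l ^+ 2)^-1 - a| <=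
      k * (- complex.Re l * (a + (mag l ^+ 2)^-1))].
Proof.
move=> k0 sec phic phiD spec.
have nc : ~ coercive D l by move=> /(coercive_resolvent D_bounded).
have l0 : l != 0 by apply/eqP => l0; apply: nc; rewrite l0; exact: coercive0.
split=> //; apply: contrapT => noa; apply: nc.
have ml : 0 < mag l by rewrite mag_gt0.
pose N := mag l ^+ 2; pose s := N^-1.
have N0 : 0 < N by rewrite exprn_gt0.
have s0 : 0 < s by rewrite invr_gt0.
pose t := - complex.Re l; pose y := complex.Im l.
pose G a := Num.max (phi a - t * (a + s)) (`|y| * `|s - a| - k * (t * (a + s))).
have Gpos a : 0 <= a -> 0 < G a.
  move=> a0; rewrite ltNge; apply/negP => Ga; apply: noa; exists a.
  by move: Ga; rewrite ge_max !subr_le0 => /andP[].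
have Gc : continuous G.
  move=> a; apply: (@continuous_max _ _ (fun a => phi a - t * (a + s))
    (fun a => `|y| * `|s - a| - k * (t * (a + s)))).
  - apply: cvgB; first exact: phic.
    by apply: cvgMl_tmp; apply: cvgD; [exact: cvg_id | exact: cvg_cst].
  - apply: cvgB; apply: cvgMl_tmp.
      by apply: cvg_norm; apply: cvgB; [exact: cvg_cst | exact: cvg_id].
    by apply: cvgMl_tmp; apply: cvgD; [exact: cvg_id | exact: cvg_cst].
have [K K0 zK] := half_embedding_bounded T.
have [a0 a0K Gmin] := EVT_min (sqr_ge0 K) (continuous_subspaceT Gc).
have g0 : 0 < G a0 by apply: Gpos; move: a0K; rewrite in_itv /= => /andP[].
have k1 : 0 < k + 1 by rewrite ltr_wpDl.
exists (G a0 / ((k + 1) * s * mag l)) => [|z].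
  by rewrite divr_gt0// !mulr_gt0.
have [->|zn0] := eqVneq z 0; first by rewrite mag0 expr0n/= mulr0 mag_ge0.
have b0 : 0 < mag z ^+ 2 by rewrite exprn_gt0// mag_gt0.
rewrite mulrAC ler_pdivrMr ?mulr_gt0//.
have [hR hI] := pencil_parts z (erefl N).
set E := mag l * _ in hR hI.
have -> : mag (pencil D l z z) * ((k + 1) * s * mag l) = (k + 1) * s * E.
  by rewrite /E; ring.
rewrite -ler_pdivlMr//.
pose a := mag (hval z) ^+ 2 / mag z ^+ 2.
have aK : a \in `[0, K ^+ 2].
  rewrite in_itv /= /a divr_ge0 ?sqr_ge0//= ler_pdivrMr// -exprMn.
  by rewrite ler_sqr ?nnegrE ?mulr_ge0 ?mag_ge0 ?(ltW K0).
apply: le_trans (Gmin _ aK) _.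
pose p := damp z / mag z ^+ 2; pose q := complex.Im (D z z) / mag z ^+ 2.
pose e := s * E / mag z ^+ 2.
have Nn0 : N != 0 by rewrite gt_eqF.
have mzn0 : mag z != 0 by rewrite mag_eq0.
have unit_scale : N * mag z ^+ 2 * e = E.
  by rewrite /e /s; field; rewrite ?Nn0 ?mzn0.
have NB : 0 < N * mag z ^+ 2 by rewrite mulr_gt0.
have hp : `|p - t * (a + s)| <= e.
  rewrite -(ler_pM2l NB) unit_scale -{1}(gtr0_norm NB) -normrM.
  apply: le_trans hR; rewrite le_eqVlt; apply/orP; left; apply/eqP; congr (`|_|).
  by rewrite /p /a /t /s; field; rewrite ?Nn0 ?mzn0.
have hq : `|q - y * (s - a)| <= e.
  rewrite -(ler_pM2l NB) unit_scale -{1}(gtr0_norm NB) -normrM.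
  apply: le_trans hI; rewrite le_eqVlt; apply/orP; left; apply/eqP; congr (`|_|).
  by rewrite /q /a /y /s; field; rewrite ?Nn0 ?mzn0.
have qp : `|q| <= k * p.
  by rewrite /q /p normrM normfV (gtr0_norm b0) mulrA ler_pM2r ?invr_gt0.
have pa : phi a <= p by exact: phiD.
have e0 : 0 <= e by apply: le_trans hp.
have -> : (k + 1) * s * E / mag z ^+ 2 = (k + 1) * e by rewrite /e; ring.
have ke : 0 <= k * e by rewrite mulr_ge0.
have p1 : p - t * (a + s) <= e by apply: le_trans hp; exact: ler_norm.
rewrite /G ge_max; apply/andP; split; first by move: p1 pa ke; lra.
rewrite -normrM.
have kp : k * (p - t * (a + s)) <= k * e by rewrite ler_wpM2l.
have : `|y * (s - a)| <= `|q| + e.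
  have -> : y * (s - a) = q - (q - y * (s - a)) by ring.
  by rewrite (le_trans (ler_normB _ _))// lerD2l.
by move: kp qp; lra.
Qed.

End NumericalRange.

(** * The boundary curves *)

Section Regions.
Variable R : realType.
Implicit Types t y s a k : R.

Lemma le_sqrt_of_sqr_le (x m : R) : x ^+ 2 <= m -> x <= Num.sqrt m.
Proof. by move=> xm; rewrite (le_trans (ler_norm x))// -sqrtr_sqr ler_wsqrtr. Qed.

(** The witness produced at a spectral point has positive [t] as soon as the
    lower bound [phi] of the damping is positive away from [0]. *)
Lemma witness_left_half_plane k (phi : R -> R) t y s a :
  phi 0 >= 0 -> (forall x, 0 < x -> 0 < phi x) -> 0 < s -> 0 <= a ->
  (t = 0 -> y != 0) -> phi a <= t * (a + s) ->
  `|y| * `|s - a| <= k * (t * (a + s)) -> 0 < t.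
Proof.
move=> phi0 phipos s0 a0 ty pa ya.
have as0 : 0 < a + s by rewrite ltr_wpDl.
have pa0 : 0 <= phi a.
  by move: a0; rewrite le_eqVlt => /predU1P[<-//|/phipos/ltW].
rewrite lt_neqAle -(pmulr_lge0 _ as0) (le_trans pa0 pa) andbT.
apply/eqP => t0; move: pa ya; rewrite -t0 mul0r mulr0 => pa.
have -> : a = 0.
  apply/eqP; rewrite eq_le a0 andbT leNgt; apply/negP => /phipos.
  by rewrite ltNge pa.
by rewrite subr0 (gtr0_norm s0) pmulr_lle0// normr_le0; apply/negP/ty.
Qed.

(** The damping bound gives [(beta - 2 t) (a + s) <= beta (s - a)]; inserting
    this into the sector condition cancels [a + s]. *)
Lemma region_i k (beta : R) t y s a : 0 <= k -> 0 < beta -> 0 < t -> 0 < s -> 0 <= a ->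
  beta * a <= t * (a + s) -> `|y| * `|s - a| <= k * (t * (a + s)) ->
  (`|y|%:E <= h_i k beta t)%E.
Proof.
move=> k0 b0 t0 s0 a0 pa ya; rewrite /h_i; case: ifPn => [tb|_]; last by rewrite leey.
have tb' : 2 * t < beta by move: tb; rewrite ltr_pdivlMr//; lra.
have bt : 0 < 1 - 2 / beta * t.
  by rewrite subr_gt0 mulrAC ltr_pdivrMr// mul1r.
rewrite lee_fin ler_pdivlMl//.
have as0 : 0 < a + s by rewrite ltr_wpDl.
rewrite -(ler_pM2r (mulr_gt0 b0 as0)).
have -> : (1 - 2 / beta * t) * `|y| * (beta * (a + s)) = `|y| * ((beta - 2 * t) * (a + s)).
  by field; rewrite gt_eqF.
apply: (@le_trans _ _ (`|y| * (beta * `|s - a|))).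
  rewrite ler_wpM2l//.
  have : beta * (s - a) <= beta * `|s - a| by rewrite ler_pM2l// ler_norm.
  by move: pa; lra.
have : beta * (`|y| * `|s - a|) <= beta * (k * (t * (a + s))) by rewrite ler_pM2l.
by lra.
Qed.

(** With [c = 2 / mu^2 + (k^2 - 1) / 2], the number [k_mu_sq k mu] is the larger
    root of [X^2 - 2 c X - k^2]; the hypothesis says that this polynomial is
    non-positive at [x]. *)
Lemma k_mu_sq_ge k (mu x : R) :
  (x - (2 / mu ^+ 2 + (k ^+ 2 - 1) / 2)) ^+ 2 <=
    (2 / mu ^+ 2 + (k ^+ 2 - 1) / 2) ^+ 2 + k ^+ 2 -> x <= k_mu_sq k mu.
Proof. by move=> /le_sqrt_of_sqr_le h; rewrite /k_mu_sq -lerBlDl. Qed.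

(** The polynomial of [k_mu_sq_ge] is non-positive at [k^2] and non-negative at
    [k^2 + 4 / mu^2 = 2 c + 1]. *)
Lemma k_mu_estimates k (mu : R) : 0 <= k ->
  [/\ 0 <= k_mu k mu, k_mu k mu ^+ 2 = k_mu_sq k mu, k <= k_mu k mu &
      k_mu k mu <= Num.sqrt (k ^+ 2 + 4 / mu ^+ 2)].
Proof.
move=> k0.
have m0 : 0 <= 1 / mu ^+ 2 by rewrite divr_ge0 ?sqr_ge0.
have kle : k ^+ 2 <= k_mu_sq k mu.
  apply: k_mu_sq_ge.
  have -> : 2 / mu ^+ 2 = 2 * (1 / mu ^+ 2) by rewrite mulrA mulr1.
  have := mulr_ge0 m0 (sqr_ge0 k); nra.
have sq0 : 0 <= k_mu_sq k mu by apply: le_trans kle; exact: sqr_ge0.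
split; first exact: sqrtr_ge0.
- by rewrite sqr_sqrtr.
- exact: le_sqrt_of_sqr_le.
- rewrite ler_wsqrtr// /k_mu_sq.
  have -> : 2 / mu ^+ 2 = 2 * (1 / mu ^+ 2) by rewrite mulrA mulr1.
  have -> : 4 / mu ^+ 2 = 4 * (1 / mu ^+ 2) by rewrite mulrA mulr1.
  move: (1 / mu ^+ 2) m0 => m m0.
  set c := 2 * m + _.
  have c1 : 0 <= c + 1 by rewrite /c; have := sqr_ge0 k; lra.
  have : Num.sqrt (c ^+ 2 + k ^+ 2) <= c + 1.
    by rewrite -[leRHS]ger0_norm// -sqrtr_sqr ler_wsqrtr// /c; nra.
  rewrite /c; lra.
Qed.

(** The aim is that the polynomial of [k_mu_sq_ge] is non-positive at
    [y^2 / t^2]. *)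
Lemma region_ii k (mu : R) t y s a : 0 <= k -> 0 < mu -> 0 < t -> 0 <= a ->
  s = (t ^+ 2 + y ^+ 2)^-1 ->
  mu * Num.sqrt a <= t * (a + s) -> `|y| * `|s - a| <= k * (t * (a + s)) ->
  `|y| <= h_ii k mu t.
Proof.
move=> k0 mu0 t0 a0 sE pa ya.
have N0 : 0 < t ^+ 2 + y ^+ 2 by rewrite ltr_wpDr ?sqr_ge0// exprn_gt0.
have s0 : 0 < s by rewrite sE invr_gt0.
have as0 : 0 < a + s by rewrite ltr_wpDl.
have [kmu0 kmuE _ _] := k_mu_estimates mu k0.
rewrite -ler_sqr ?nnegrE ?mulr_ge0// ?(ltW t0)// exprMn kmuE.
rewrite -ler_pdivrMr ?exprn_gt0// real_normK ?num_real//; apply: k_mu_sq_ge.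
have pa2 : mu ^+ 2 * a <= t ^+ 2 * (a + s) ^+ 2.
  have : (mu * Num.sqrt a) ^+ 2 <= (t * (a + s)) ^+ 2.
    by rewrite ler_sqr ?nnegrE ?mulr_ge0 ?sqrtr_ge0// ltW.
  by rewrite !exprMn sqr_sqrtr.
have ya2 : y ^+ 2 * (s - a) ^+ 2 <= k ^+ 2 * (t ^+ 2 * (a + s) ^+ 2).
  have : (`|y| * `|s - a|) ^+ 2 <= (k * (t * (a + s))) ^+ 2.
    by rewrite ler_sqr ?nnegrE ?mulr_ge0// ltW.
  by rewrite !exprMn !real_normK ?num_real.
(* [(a + s)^2 = (s - a)^2 + 4 a s] bounds [a + s] through the two hypotheses *)
have main : y ^+ 2 * mu ^+ 2 <= mu ^+ 2 * k ^+ 2 * t ^+ 2 + 4 * s * y ^+ 2 * t ^+ 2.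
  have as2 : 0 < (a + s) ^+ 2 by rewrite exprn_gt0.
  rewrite -(ler_pM2r as2).
  have h1 : mu ^+ 2 * (y ^+ 2 * (s - a) ^+ 2) <= mu ^+ 2 * (k ^+ 2 * (t ^+ 2 * (a + s) ^+ 2)).
    by rewrite ler_wpM2l ?sqr_ge0.
  have h2 : 4 * s * y ^+ 2 * (mu ^+ 2 * a) <= 4 * s * y ^+ 2 * (t ^+ 2 * (a + s) ^+ 2).
    by rewrite ler_wpM2l// mulr_ge0 ?sqr_ge0// mulr_ge0// ltW.
  by move: h1 h2; lra.
have t20 : 0 < t ^+ 2 by rewrite exprn_gt0.
have mu20 : 0 < mu ^+ 2 by rewrite exprn_gt0.
set c := 2 / mu ^+ 2 + _; set x := y ^+ 2 / t ^+ 2.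
rewrite -subr_ge0.
have -> : c ^+ 2 + k ^+ 2 - (x - c) ^+ 2 =
   (t ^+ 2 + y ^+ 2) / (t ^+ 2 * t ^+ 2 * mu ^+ 2) *
   (mu ^+ 2 * k ^+ 2 * t ^+ 2 + 4 * s * y ^+ 2 * t ^+ 2 - y ^+ 2 * mu ^+ 2).
  by rewrite /c /x sE; field; rewrite !gt_eqF.
apply: mulr_ge0; last by rewrite subr_ge0.
by apply: divr_ge0; rewrite ltW// (mulr_gt0 (mulr_gt0 t20 t20)).
Qed.

Section Cubic.
Variables (k d : R).
Hypotheses (k0 : 0 <= k) (d0 : 0 <= d).

Lemma h_iii_sol_ge t y : 0 <= t -> h_iii_sol k d t y -> k * t <= y.
Proof.
move=> t0 [y0 yE]; have e0 : 0 <= d^-1 by rewrite invr_ge0.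
have [N0|] := ltP 0 (y ^+ 2 + t ^+ 2).
  by rewrite -subr_ge0 -(pmulr_rge0 _ N0) yE !mulr_ge0.
rewrite le_eqVlt ltNge addr_ge0 ?sqr_ge0// orbF paddr_eq0 ?sqr_ge0//.
by rewrite !sqrf_eq0 => /andP[/eqP -> /eqP ->]; rewrite mulr0.
Qed.

Lemma h_iii_sol_le1 t y : 0 <= t -> h_iii_sol k d t y -> y <= k * t + 1 / d.
Proof.
move=> t0 [y0 yE]; have e0 : 0 <= d^-1 by rewrite invr_ge0.
have kt0 : 0 <= k * t by exact: mulr_ge0.
have [N0|] := ltP 0 (y ^+ 2 + t ^+ 2); last first.
  rewrite le_eqVlt ltNge addr_ge0 ?sqr_ge0// orbF paddr_eq0 ?sqr_ge0//.
  by rewrite !sqrf_eq0 => /andP[/eqP -> _]; rewrite addr_ge0// mul1r.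
rewrite mul1r -lerBlDl -(ler_pM2l N0) yE.
have := mulr_ge0 e0 (sqr_ge0 (y - t)); lra.
Qed.

Lemma h_iii_sol_le2 t y : 0 <= t -> h_iii_sol k d t y ->
  y <= k * t / 2 + Num.sqrt ((k * t / 2) ^+ 2 + 2 * t / d).
Proof.
move=> t0 hy; have kty := h_iii_sol_ge t0 hy; have [y0 yE] := hy.
have e0 : 0 <= d^-1 by rewrite invr_ge0.
rewrite -lerBlDl; apply: le_sqrt_of_sqr_le.
suff : y * (y - k * t) <= 2 * t / d by lra.
have [->|yn0] := eqVneq y 0; first by rewrite mul0r !mulr_ge0.
have yp : 0 < y by rewrite lt_neqAle eq_sym yn0.
rewrite -(ler_pM2l yp).
have : 0 <= t ^+ 2 * (y - k * t) by rewrite mulr_ge0 ?sqr_ge0// subr_ge0.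
by move: yE; lra.
Qed.

(** The cubic is non-negative from [k t + 1 / d] on, so there is a root to the
    right of every point where it is non-positive. *)
Lemma h_iii_sol_above t y : 0 <= t -> 0 <= y ->
  (y ^+ 2 + t ^+ 2) * (y - k * t) <= 2 / d * t * y ->
  exists2 x, y <= x & h_iii_sol k d t x.
Proof.
move=> t0 y0 yle; have e0 : 0 <= d^-1 by rewrite invr_ge0.
have kt0 : 0 <= k * t by exact: mulr_ge0.
pose p x := (x ^+ 2 + t ^+ 2) * (x - k * t) - 2 / d * t * x.
pose b := y + k * t + d^-1.
have yb : y <= b by rewrite /b -addrA lerDl addr_ge0.
have pb : 0 <= p b.
  have -> : p b = (b ^+ 2 + t ^+ 2) * (b - k * t - d^-1) + d^-1 * (b - t) ^+ 2.
    by rewrite /p; ring.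
  have bkt : 0 <= b - k * t - d^-1.
    by rewrite (_ : _ - _ = y) // /b; ring.
  by apply: addr_ge0; apply: mulr_ge0; rewrite ?bkt ?addr_ge0 ?sqr_ge0.
have py : p y <= 0 by rewrite subr_le0.
have pc : {within `[y, b], continuous p}.
  apply: continuous_subspaceT => x.
  apply: cvgB; last by apply: cvgMl_tmp; exact: cvg_id.
  apply: cvgM; first by apply: cvgD; [exact: exprn_continuous | exact: cvg_cst].
  by apply: cvgB; [exact: cvg_id | exact: cvg_cst].
have [|x] := IVT (v := 0) yb pc.
  by rewrite ge_min py/= le_max pb orbT.
rewrite in_itv/= => /andP[yx _] /eqP; rewrite subr_eq0 => /eqP xE.
by exists x => //; split=> //; exact: le_trans yx.
Qed.

Lemma h_iii_sol_closed t : closed (h_iii_sol k d t).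
Proof.
pose p (x : R) := (x ^+ 2 + t ^+ 2) * (x - k * t) - 2 / d * t * x.
have -> : h_iii_sol k d t = [set x | 0 <= x] `&` p @^-1` [set 0].
  apply/seteqP; split=> x [x0 xE]; split=> //=; first by rewrite /p xE subrr.
  by apply/eqP; rewrite -subr_eq0; apply/eqP.
apply: closedI; first exact: closed_ge.
apply: closed_comp; last exact: closed_eq.
move=> x _.
apply: cvgB; last by apply: cvgMl_tmp; exact: cvg_id.
apply: cvgM; first by apply: cvgD; [exact: exprn_continuous | exact: cvg_cst].
by apply: cvgB; [exact: cvg_id | exact: cvg_cst].
Qed.

(** The roots form a nonempty, bounded and closed set, which contains its
    supremum. *)
Lemma h_iii_largest t : 0 <= t ->
  is_largest (h_iii_sol k d t) (sup (h_iii_sol k d t)).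
Proof.
move=> t0; set A := h_iii_sol k d t.
have A0 : A !=set0.
  have [|x _ xA] := @h_iii_sol_above t 0 t0 (lexx 0); last by exists x.
  by rewrite mulr0 sub0r mulrN oppr_le0 !mulr_ge0 ?addr_ge0 ?sqr_ge0.
have Aub : has_ubound A by exists (k * t + 1 / d) => y; exact: h_iii_sol_le1.
split; last by apply: sup_upper_bound.
rewrite [A in A _](closure_id A).1; last exact: h_iii_sol_closed.
exact: closure_sup.
Qed.

Lemma h_iii_estimates t : 0 <= t ->
  let h := sup (h_iii_sol k d t) in
  [/\ k * t <= h,
      h <= Num.min (k * t + 1 / d)
             (k * t / 2 + Num.sqrt ((k * t / 2) ^+ 2 + 2 * t / d)) &
      Num.min (k * t + 1 / d)
        (k * t / 2 + Num.sqrt ((k * t / 2) ^+ 2 + 2 * t / d)) <=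
      k * t + Num.min (1 / d) (Num.sqrt (2 * t / d))].
Proof.
move=> t0 h; have [hA _] := h_iii_largest t0.
split; first exact: h_iii_sol_ge hA.
  by rewrite le_min h_iii_sol_le1//= h_iii_sol_le2.
rewrite addr_minr le_min; apply/andP; split; first by rewrite ge_min lexx.
rewrite ge_min; apply/orP; right.
have kt0 : 0 <= k * t / 2 by rewrite divr_ge0 ?mulr_ge0.
have td0 : 0 <= 2 * t / d by rewrite divr_ge0 ?mulr_ge0.
have w0 := sqrtr_ge0 (2 * t / d); have w2 := sqr_sqrtr td0.
set w := Num.sqrt (2 * t / d) in w0 w2 *.
have : Num.sqrt ((k * t / 2) ^+ 2 + 2 * t / d) <= k * t / 2 + w.
  rewrite -[leRHS]ger0_norm ?addr_ge0// -sqrtr_sqr ler_wsqrtr// -w2.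
  have := mulr_ge0 kt0 w0; lra.
lra.
Qed.

(** From [|y| (a + s) = |y| (a - s) + 2 |y| s] and the sector condition,
    [(|y| - k t) (a + s) <= 2 |y| s]; with the damping bound this says that the
    cubic of [h_iii] is non-positive at [|y|]. *)
Lemma region_iii t y s a : 0 < d -> 0 < t -> 0 <= a ->
  s = (t ^+ 2 + y ^+ 2)^-1 ->
  d <= t * (a + s) -> `|y| * `|s - a| <= k * (t * (a + s)) ->
  `|y| <= sup (h_iii_sol k d t).
Proof.
move=> dp t0 a0 sE pa ya.
have N0 : 0 < t ^+ 2 + y ^+ 2 by rewrite ltr_wpDr ?sqr_ge0// exprn_gt0.
have s0 : 0 < s by rewrite sE invr_gt0.
have [_ ub] := h_iii_largest (ltW t0).
suff [x yx xA] : exists2 x, `|y| <= x & h_iii_sol k d t x.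
  by rewrite (le_trans yx)// ub.
apply: h_iii_sol_above => //; first exact: ltW.
rewrite real_normK ?num_real//.
have d1 : 0 < d^-1 by rewrite invr_gt0.
have [ykt|kty] := leP `|y| (k * t).
  apply: (@le_trans _ _ 0); last by rewrite !mulr_ge0// ltW.
  by rewrite mulr_ge0_le0 ?subr_le0// addr_ge0 ?sqr_ge0.
have h1 : (`|y| - k * t) * d <= (`|y| - k * t) * (t * (a + s)).
  by rewrite ler_wpM2l// subr_ge0 ltW.
have h2 : `|y| * (a - s) <= `|y| * `|s - a|.
  by rewrite ler_wpM2l// distrC ler_norm.
have h3 : (`|y| - k * t) * d <= t * (2 * `|y| * s).
  have : t * ((`|y| - k * t) * (a + s)) <= t * (2 * `|y| * s).
    by rewrite ler_pM2l//; move: h2 ya; lra.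
  by move: h1; lra.
rewrite addrC -(ler_pM2r dp).
have : (t ^+ 2 + y ^+ 2) * ((`|y| - k * t) * d) <=
    (t ^+ 2 + y ^+ 2) * (t * (2 * `|y| * s)) by rewrite ler_pM2l.
have -> : (t ^+ 2 + y ^+ 2) * (t * (2 * `|y| * s)) = 2 / d * t * `|y| * d.
  by rewrite sE; field; rewrite !gt_eqF.
by rewrite mulrA.
Qed.

End Cubic.
End Regions.

(** * Assembling the spectral inclusions *)

Section Spectrum.
Variables (R : realType) (H : hilbertType R) (T : positive_operator H).
Local Notation Hhalf := (Hhalf T).
Variable D : {linear Hhalf -> Hmhalf T}.
Hypothesis D_bounded : bounded_operator D.
Local Notation damp z := (complex.Re (D z z)).

Lemma spectrum_trivial (l : R[i]) : (forall z : Hhalf, z = 0) ->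
  ~ spectrum (system_operator D) l.
Proof.
move=> H0; apply; apply: coercive_resolvent => //; exists 1 => // z.
by rewrite (H0 z) mag0 expr0n mulr0 mag_ge0.
Qed.

(** A positive infimum of real numbers over a nonempty set is finite. *)
Lemma fine_ereal_inf_gt0 (U : Type) (A : set U) (q : U -> R) : A !=set0 ->
  (0 < ereal_inf [set (q z)%:E | z in A])%E ->
  0 < fine (ereal_inf [set (q z)%:E | z in A]) /\
  forall z, A z -> fine (ereal_inf [set (q z)%:E | z in A]) <= q z.
Proof.
move=> [z0 Az0]; set m := ereal_inf _ => m0.
have mq z : A z -> (m <= (q z)%:E)%E by move=> Az; apply: ereal_inf_lbound; exists z.
have mfin : m \is a fin_num.
  by rewrite fin_real// (lt_trans _ m0) ?ltNyr//= (le_lt_trans (mq _ Az0))// ltry.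
split; first by rewrite -lte_fin fineK.
by move=> z Az; rewrite -lee_fin fineK// mq.
Qed.

(** If [H] is not zero, [gamma] is non-negative because the damping is, so
    [Re l < - gamma] implies [Re l < 0] and [coercive_left] applies. *)
Lemma spectrum_gamma (l : R[i]) : (forall z : Hhalf, 0 <= damp z) ->
  spectrum (system_operator D) l ->
  (- damping_gamma D <= (complex.Re l)%:E)%E.
Proof.
move=> acc spec; have [triv|] := pselect (forall z : Hhalf, z = 0).
  by have := spectrum_trivial triv spec.
move=> /existsNP[z0 /eqP z0n0]; rewrite leNgt; apply/negP; rewrite lteNr -EFinN => gl.
have gz (z : Hhalf) : z != 0 -> damp z / mag (hval z) ^+ 2 < - complex.Re l.
  move=> zn0; rewrite -lte_fin; apply: le_lt_trans gl.
  by apply: ereal_sup_ubound; exists z.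
have l0 : complex.Re l < 0.
  by rewrite -oppr_gt0; apply: le_lt_trans (gz _ z0n0); rewrite divr_ge0 ?sqr_ge0.
apply: spec; apply: coercive_resolvent => //; apply: coercive_left => // z.
have [->|zn0] := eqVneq z 0.
  by rewrite antidual0r mulr_ge0 ?sqr_ge0// oppr_ge0 ltW.
have a0 : 0 < mag (hval z) ^+ 2 by rewrite exprn_gt0// mag_gt0 hval_eq0.
by rewrite -ler_pdivrMr// ltW// gz.
Qed.

(** [spectrum_witness] once the damping is known to be positive: the spectral
    point then lies in the open left half-plane, and [- Re l = |Re l|]. *)
Lemma spectrum_constraints (k : R) (phi : R -> R) (l : R[i]) : 0 <= k ->
  (forall z : Hhalf, `|complex.Im (D z z)| <= k * damp z) ->
  continuous phi -> 0 <= phi 0 -> (forall x, 0 < x -> 0 < phi x) ->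
  (forall z : Hhalf, z != 0 ->
     phi (mag (hval z) ^+ 2 / mag z ^+ 2) <= damp z / mag z ^+ 2) ->
  spectrum (system_operator D) l ->
  let t := `|complex.Re l| in let y := complex.Im l in
  let s := (t ^+ 2 + y ^+ 2)^-1 in
  complex.Re l < 0 /\ exists a, [/\ 0 <= a, phi a <= t * (a + s) &
    `|y| * `|s - a| <= k * (t * (a + s))].
Proof.
move=> k0 sec phic phi0 phip phiD spec t y s.
have [l0 [a [a0 pa ya]]] := spectrum_witness D_bounded k0 sec phic phiD spec.
have sE : (mag l ^+ 2)^-1 = s.
  by rewrite /s mag_sqr /t real_normK// num_real.
have s0 : 0 < (mag l ^+ 2)^-1 by rewrite invr_gt0 exprn_gt0// mag_gt0.
have t0 : 0 < - complex.Re l.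
  apply: (witness_left_half_plane phi0 phip s0 a0 _ pa ya) => /eqP.
  rewrite oppr_eq0 => /eqP Re0; apply/eqP => Im0; move/eqP: l0; apply.
  by move: Re0 Im0; case: (l) => ? ? /= -> ->.
have l0' : complex.Re l < 0 by rewrite -oppr_gt0.
split=> //; exists a; have tE : t = - complex.Re l by rewrite /t ltr0_norm.
by rewrite tE -sE.
Qed.

End Spectrum.

Theorem theorem6p2 (R : realType) (H : hilbertType R) (T : positive_operator H)
    (D : {linear Hhalf T -> Hmhalf T})
    (D_bounded : bounded_operator D)
    (D_accretive : forall z : Hhalf T, 0 <= complex.Re (D z z))
    (D_H1 : forall z : Hhalf T, dom T (hval z) -> range (@pivot R H T) (D z))
    (k : R) (k_ge0 : 0 <= k)
    (D_sectorial : forall z : Hhalf T, dom T (hval z) ->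
       `|complex.Im (D z z)| <= k * complex.Re (D z z)) :
  let A := system_operator D in
  let beta := damping_beta D in
  let gamma := damping_gamma D in
  let delta := damping_delta D in
  let mu := damping_mu D in
  [/\ (0 < beta)%E ->
        spectrum A `<=`
          [set l | complex.Re l < 0 /\
            (`|complex.Im l|%:E <= h_i k (fine beta) `|complex.Re l|)%E] /\
        ((gamma < +oo)%E ->
         (exists2 l0, resolvent_set A l0 & ((complex.Re l0)%:E < - gamma)%E) ->
         spectrum A `<=`
          [set l | [/\ (- gamma <= (complex.Re l)%:E)%E, complex.Re l < 0 &
            (`|complex.Im l|%:E <= h_i k (fine beta) `|complex.Re l|)%E]]),
      (0 < mu)%E ->
        spectrum A `<=`
          [set l | [/\ (- gamma <= (complex.Re l)%:E)%E, complex.Re l < 0 &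
            `|complex.Im l| <= h_ii k (fine mu) `|complex.Re l|]] /\
        [/\ 0 <= k_mu k (fine mu),
            k_mu k (fine mu) ^+ 2 = k_mu_sq k (fine mu),
            k <= k_mu k (fine mu) &
            k_mu k (fine mu) <= Num.sqrt (k ^+ 2 + 4 / fine mu ^+ 2)] &
      (0 < delta)%E ->
        exists h_iii : R -> R,
        [/\ forall t, 0 <= t ->
              is_largest (h_iii_sol k (fine delta) t) (h_iii t),
            spectrum A `<=`
              [set l | [/\ (- gamma <= (complex.Re l)%:E)%E, complex.Re l < 0 &
                `|complex.Im l| <= h_iii `|complex.Re l|]] &
            forall t, 0 <= t ->
              [/\ k * t <= h_iii t,
                  h_iii t <= Num.min (k * t + 1 / fine delta)
                    (k * t / 2 +
                     Num.sqrt ((k * t / 2) ^+ 2 + 2 * t / fine delta)) &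
                  Num.min (k * t + 1 / fine delta)
                    (k * t / 2 +
                     Num.sqrt ((k * t / 2) ^+ 2 + 2 * t / fine delta)) <=
                  k * t + Num.min (1 / fine delta)
                    (Num.sqrt (2 * t / fine delta))]]].
Proof.
move=> A beta gamma delta mu.
have sec := sector_half D_bounded k_ge0 D_sectorial.
have gam l := @spectrum_gamma _ _ _ _ D_bounded l D_accretive.
have [triv|] := pselect (forall z : Hhalf T, z = 0).
  (* On the zero space the spectrum is empty; the infima are [+oo], which [fine]
     sends to [0], and the estimates on the curves hold at that value too. *)
  have empty : forall B, spectrum A `<=` B.
    by move=> B l /(spectrum_trivial D_bounded triv).
  have fd : 0 <= fine delta.
    rewrite /delta /damping_delta (_ : [set _ | _ in _] = set0) ?ereal_inf0//.
    by apply/seteqP; split=> // x [z /eqP zn0 _]; have := triv z.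
  split=> [_|_|_]; first by split=> [|_ _]; exact: empty.
    by split; [exact: empty | exact: k_mu_estimates].
  exists (fun t => sup (h_iii_sol k (fine delta) t)).
  split; last by move=> t t0; exact: h_iii_estimates.
    by move=> t t0; exact: h_iii_largest.
  exact: empty.
move=> /existsNP[z0 /eqP z0n0].
have nz : [set z : Hhalf T | z != 0] !=set0 by exists z0.
have magp (z : Hhalf T) : z != 0 -> 0 < mag z by rewrite mag_gt0.
have maghp (z : Hhalf T) : z != 0 -> 0 < mag (hval z) by rewrite mag_gt0 hval_eq0.
split.
- move=> /(fine_ereal_inf_gt0 nz)[b0 bD].
  have incl l : spectrum A l -> complex.Re l < 0 /\
      (`|complex.Im l|%:E <= h_i k (fine beta) `|complex.Re l|)%E.
    move=> spec.
    have [||||l0 [a [a0 pa ya]]] := spectrum_constraints (phi := *%R (fine beta))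
        D_bounded k_ge0 sec _ _ _ _ spec.
    + by move=> x; apply: cvgMl_tmp; exact: cvg_id.
    + by rewrite mulr0.
    + by move=> x x0; rewrite mulr_gt0.
    + move=> z zn0; rewrite mulrA ler_pM2r ?invr_gt0 ?exprn_gt0 ?magp//.
      by rewrite -ler_pdivlMr ?exprn_gt0 ?maghp//; exact: bD.
    split=> //; apply: region_i pa ya => //; first by rewrite normr_gt0 lt_eqF.
    by rewrite invr_gt0 ltr_wpDr ?sqr_ge0// exprn_gt0// normr_gt0 lt_eqF.
  split=> [l /incl//|_ _ l spec]; have [? ?] := incl _ spec.
  by split=> //; exact: gam.
- move=> /(fine_ereal_inf_gt0 nz)[m0 mD]; split; last exact: k_mu_estimates.
  move=> l spec.
  have [||||l0 [a [a0 pa ya]]] := spectrum_constraints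
      (phi := fun x => fine mu * Num.sqrt x) D_bounded k_ge0 sec _ _ _ _ spec.
  + by move=> x; apply: cvgMl_tmp; exact: sqrt_continuous.
  + by rewrite sqrtr0 mulr0.
  + by move=> x x0; rewrite mulr_gt0 ?sqrtr_gt0.
  + move=> z zn0; have zp := magp _ zn0; have hp := maghp _ zn0.
    rewrite -expr_div_n sqrtr_sqr ger0_norm ?divr_ge0 ?mag_ge0//.
    have := mD z zn0; rewrite ler_pdivlMr ?mulr_gt0// => h.
    rewrite ler_pdivlMr ?exprn_gt0//; apply: le_trans h.
    rewrite le_eqVlt; apply/orP; left; apply/eqP.
    by rewrite -/(mag z) -/(mag (hval z)); field; rewrite gt_eqF.
  split=> //; first exact: gam.
  by apply: region_ii pa ya => //; rewrite normr_gt0 lt_eqF.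
- move=> /(fine_ereal_inf_gt0 nz)[d0 dD].
  exists (fun t => sup (h_iii_sol k (fine delta) t)).
  have d0' := ltW d0.
  split; last by move=> t t0; exact: h_iii_estimates.
    by move=> t t0; exact: h_iii_largest.
  move=> l spec.
  have [||||l0 [a [a0 pa ya]]] := spectrum_constraints
      (phi := fun=> fine delta) D_bounded k_ge0 sec _ _ _ _ spec.
  + by move=> x; exact: cvg_cst.
  + exact: ltW.
  + by [].
  + by move=> z zn0; exact: dD.
  split=> //; first exact: gam.
  by apply: region_iii pa ya => //; rewrite normr_gt0 lt_eqF.
Qed.
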